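(* If $\lambda$ is not an eigenvalue of $L$ (operator and notation as defined in the context), then for $\mathbf h^1\in\mathbb{C}^{N^*}$, $\mathbf h^2\in\mathbb{C}^{M^*}$ we have $$(\lambda-L)^{-1}\begin{bmatrix}0\\ \mathbf h^1\\ \mathbf h^2\end{bmatrix}=\begin{bmatrix}f\\ \mathbf f^1\\ \mathbf f^2\end{bmatrix},$$ where $$f=A\,\chi_{[-a,0)}u_-+B\,\chi_{(0,b]}v_+.$$ Here $$\begin{bmatrix}A\\ B\end{bmatrix}=\Lambda\begin{bmatrix}\langle\mathbf h^1,\mathbf p\rangle\\ \langle\mathbf h^2,\mathbf q\rangle\end{bmatrix}$$ with $$\mathbf p=\begin{cases}(\lambda I-[c_i])^{-1}\mathbf b,&\eta=0,\\ \mu(\lambda)(\lambda I-[\gamma_i])^{-1}\boldsymbol\beta,&\eta>0,\end{cases}\qquad \mathbf q=\begin{cases}(\lambda I-[d_j])^{-1}\mathbf a,&\kappa=0,\\ \nu(\lambda)(\lambda I-[\delta_j])^{-1}\boldsymbol\alpha,&\kappa>0,\end{cases}$$ $$\Lambda=\frac1D\begin{bmatrix}-v_+(0^+)& -v_+'(0^+)+\mu(\lambda)v_+(0^+)\\ -u_-(0^-)-\nu(\lambda)u_-'(0^-)& -u_-'(0^-)\end{bmatrix}$$ and $$D=u_-'(0^-)v_+(0^+)-\big(v_+'(0^+)-\mu(\lambda)v_+(0^+)\big)\big(u_-(0^-)+\nu(\lambda)u_-'(0^-)\big).$$ Therefore $f$, $\mathbf f^1$ and $\mathbf f^2$ are given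 uniquely. At poles, $f$ can be determined by residue calculations. Also, $$-\boldsymbol\beta\Delta' f+(\lambda I-[\gamma_i])\mathbf f^1=\mathbf h^1\ \ (\eta>0),\qquad -\mathbf b f(0^+)+(\lambda I-[c_i])\mathbf f^1=\mathbf h^1\ \ (\eta=0),$$ $$-\boldsymbol\alpha\Delta f+(\lambda I-[\delta_j])\mathbf f^2=\mathbf h^2\ \ (\kappa>0),\qquad -\mathbf a f'(0^-)+(\lambda I-[d_j])\mathbf f^2=\mathbf h^2\ \ (\kappa=0).$$
   Context: Let $a,b>0$, $q\in L^2(-a,b)$, $\alpha\in[0,\pi)$, $\beta\in(0,\pi]$, and $\ell y:=-y''+qy$. Let $N,M\in\mathbb{N}_0$ (empty sums are $0$), $\eta,\kappa\ge 0$, $\xi,\zeta\in\mathbb{R}$, real numbers $c_1<\dots<c_N$ and $d_1<\dots<d_M$, and $b_i>0$ ($i=1,\dots,N$), $a_j>0$ ($j=1,\dots,M$). Put $$\mu(\lambda)=-\Big(\lambda\eta-\xi-\sum_{i=1}^N\frac{b_i^2}{\lambda-c_i}\Big),\qquad \nu(\lambda)=\lambda\kappa+\zeta-\sum_{j=1}^M\frac{a_j^2}{\lambda-d_j}.$$ If $\eta>0$ write $\frac1{\mu(\lambda)}=\sigma-\sum_{i=1}^{N'}\frac{\beta_i^2}{\lambda-\gamma_i}$ with $N'\in\mathbb{N}$, $\gamma_1<\dots<\gamma_{N'}$, $\beta_i>0$; if $\kappa>0$ write $\frac1{\nu(\lambda)}=\tau+\sum_{j=1}^{M'}\frac{\alpha_j^2}{\lambda-\delta_j}$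 with $M'\in\mathbb{N}$, $\delta_1<\dots<\delta_{M'}$, $\alpha_j>0$. Bold letters denote vectors: $\boldsymbol\beta=(\beta_i)$, $\boldsymbol\alpha=(\alpha_j)$, $\mathbf b=(b_i)$, $\mathbf a=(a_j)$; $[\gamma_i],[\delta_j],[c_i],[d_j]$ denote the corresponding diagonal matrices. On vectors, $\langle\cdot,\cdot\rangle$ denotes the Euclidean inner product. For a function $y$ on $(-a,0)\cup(0,b)$ write $y(0^\pm),y'(0^\pm)$ for one-sided limits at $0$, $\Delta y=y(0^+)-y(0^-)$, $\Delta' y=y'(0^+)-y'(0^-)$. $\chi_S$ is the indicator function of $S$. Operator $L$: let $\mathcal H=L^2(-a,b)\oplus\mathbb{C}^{N^*}\oplus\mathbb{C}^{M^*}$, where $N^*=N'$ if $\eta>0$, $N^*=N$ if $\eta=0$, $M^*=M'$ if $\kappa>0$, $M^*=M$ if $\kappa=0$, with inner product $\langle Y,Z\rangle=\int_{-a}^b y\bar z\,dx+\langle\mathbf y^1,\mathbf z^1\rangle+\langle\mathbf y^2,\mathbf z^2\rangle$. For $Y=(y,\mathbf y^1,\mathbf y^2)$ set $LY=(\ell y,[LY]_1,[LY]_2)$, where $[LY]_1=\boldsymbol\beta\Delta' y+[\gamma_i]\mathbf y^1$ if $\eta>0$, $[LY]_1=\mathbf b\,y(0^+)+[c_i]\mathbf y^1$ if $\eta=0$; $[LY]_2=\boldsymbol\alpha\Delta y+[\delta_j]\mathbf y^2$ if $\kappa>0$, $[LY]_2=\mathbf a\,y'(0^-)+[d_j]\mathbf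 y^2$ if $\kappa=0$. The domain $\mathcal D(L)$ consists of all $Y\in\mathcal H$ such that $y_1:=y|_{(-a,0)}$ has $y_1,y_1',\ell y_1\in L^2(-a,0)$ and $y(-a)\cos\alpha=y'(-a)\sin\alpha$; $y_2:=y|_{(0,b)}$ has $y_2,y_2',\ell y_2\in L^2(0,b)$ and $y(b)\cos\beta=y'(b)\sin\beta$; $-y(0^+)+\sigma\Delta' y-\langle\mathbf y^1,\boldsymbol\beta\rangle=0$ if $\eta>0$, $\ \Delta' y-\xi y(0^+)-\langle\mathbf y^1,\mathbf b\rangle=0$ if $\eta=0$; $y'(0^-)-\tau\Delta y-\langle\mathbf y^2,\boldsymbol\alpha\rangle=0$ if $\kappa>0$, $\ -\Delta y+\zeta y'(0^-)-\langle\mathbf y^2,\mathbf a\rangle=0$ if $\kappa=0$. Solutions: $u_-=u_-(\cdot;\lambda)$ is the solution of $\ell u=\lambda u$ on $[-a,0)$ with $u_-(-a)=\sin\alpha$, $u_-'(-a)=\cos\alpha$; $v_+=v_+(\cdot;\lambda)$ is the solution of $\ell v=\lambda v$ on $(0,b]$ with $v_+(b)=\sin\beta$, $v_+'(b)=\cos\beta$.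
   Formalization: In ⟨h¹,p⟩ and ⟨h²,q⟩ the product is taken bilinear (no complex conjugation) rather than as the Hermitian Euclidean inner product, since with conjugation the formula for A, B fails at nonreal λ; for real λ both agree. *)

(* Defs.v *)
From HB Require Import structures.
From mathcomp Require Import all_boot all_order all_algebra.
From mathcomp Require Import all_classical all_reals all_analysis.
From mathcomp Require Import complex.
Set Implicit Arguments.
Unset Strict Implicit.
Unset Printing Implicit Defensive.
Import Order.TTheory GRing.Theory Num.Theory.
Import numFieldNormedType.Exports.
Local Open Scope classical_set_scope.
Local Open Scope complex_scope.
Local Open Scope ring_scope.

(* The library's derivative, Lebesgue integral and L^p predicate are real-valued,
   so they are applied to real and imaginary parts; the topology of [R[i]] is
   available on the regular algebra [R[i]^o]. *)

Section ComplexValued.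
Context {R : realType}.
Implicit Types (y g dg : R -> R[i]) (D : set R).

Definition limR y (x : R) : R[i] := lim ((y t : R[i]^o) @[t --> x^'+]).
Definition limL y (x : R) : R[i] := lim ((y t : R[i]^o) @[t --> x^'-]).

Definition derivableC y (x : R) : Prop :=
  derivable (fun t => complex.Re (y t)) x 1 /\ derivable (fun t => complex.Im (y t)) x 1.

Definition derivC y (x : R) : R[i] :=
  derive1 (fun t => complex.Re (y t)) x +i* derive1 (fun t => complex.Im (y t)) x.

Definition integrableC D y : Prop :=
  lebesgue_measure.-integrable D (EFin \o (fun t => complex.Re (y t))) /\
  lebesgue_measure.-integrable D (EFin \o (fun t => complex.Im (y t))).

Definition integralC D y : R[i] :=
  (\int[lebesgue_measure]_(t in D) complex.Re (y t)) +i*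
  (\int[lebesgue_measure]_(t in D) complex.Im (y t)).

Definition L2 (l r : R) y : Prop :=
  ((fun t => complex.Re (y t)) \_ `]l, r[) \in Lfun lebesgue_measure 2%:E /\
  ((fun t => complex.Im (y t)) \_ `]l, r[) \in Lfun lebesgue_measure 2%:E.

Definition ae_eq_on (l r : R) y g : Prop :=
  {ae lebesgue_measure, forall x : R, x \in `]l, r[ -> y x = g x}.

(* [g] is locally absolutely continuous on (l,r) with a.e. derivative [dg]. *)
Definition loc_AC (l r : R) g dg : Prop :=
  forall x y : R, l < x -> x <= y -> y < r ->
    integrableC `[x, y] dg /\ g y - g x = integralC `[x, y] dg.

(* [- y'' + q y] makes sense on (l,r) and equals [w] almost everywhere: [y] is
   differentiable, [y'] is locally absolutely continuous, and [ddy] is y''. *)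
Definition is_ell (q : R -> R[i]) (l r : R) y w : Prop :=
  (forall x : R, x \in `]l, r[ -> derivableC y x) /\
  exists ddy, loc_AC l r (derivC y) ddy /\
    ae_eq_on l r w (fun x => - ddy x + q x * y x).

End ComplexValued.

Definition sel {R : Type} (m n : nat) (t : bool)
    (x : 'cV[R]_m) (y : 'cV[R]_n) : 'cV[R]_(if t then m else n) :=
  if t return 'cV[R]_(if t then m else n) then x else y.

Definition vecC {R : realType} n (x : 'cV[R]_n) : 'cV[R[i]]_n :=
  map_mx (real_complex R) x.

Definition diagC {R : realType} n (x : 'cV[R]_n) : 'M[R[i]]_n :=
  diag_mx (vecC x)^T.

(* The Euclidean product is read bilinearly.  Where one argument is real this is
   the usual one; for [pvec] and [qvec] below at nonreal lambda, conjugating the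
   second argument would give a false formula. *)
Definition dot {R : realType} n (x y : 'cV[R[i]]_n) : R[i] :=
  \sum_(i < n) x i 0 * y i 0.

Definition col2 {R : realType} (x y : R[i]) : 'cV[R[i]]_2 :=
  \col_(i < 2) if i == 0 then x else y.

Definition mx2 {R : realType} (x11 x12 x21 x22 : R[i]) : 'M[R[i]]_2 :=
  \matrix_(i < 2, j < 2)
    if i == 0 then (if j == 0 then x11 else x12)
    else (if j == 0 then x21 else x22).

Definition increasing {R : realType} n (x : 'cV[R]_n) : Prop :=
  forall i j : 'I_n, (i < j)%N -> x i 0 < x j 0.

(* [N1], [M1] stand for N', M'; the suffix [v] marks the boldface vectors and
   the sequences c, d, gamma, delta. *)
Record problem (R : realType) := Problem {
  lenA : R; lenB : R; q : R -> R[i]; alpha : R; beta : R;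
  N : nat; M : nat; eta : R; kappa : R; xi : R; zeta : R;
  cv : 'cV[R]_N; bv : 'cV[R]_N; dv : 'cV[R]_M; av : 'cV[R]_M;
  N1 : nat; M1 : nat; sigma : R; tau : R;
  gammav : 'cV[R]_N1; betav : 'cV[R]_N1;
  deltav : 'cV[R]_M1; alphav : 'cV[R]_M1 }.

Definition off {R : realType} n (x : 'cV[R]_n) (z : R[i]) : Prop :=
  forall i, z != (x i 0)%:C.

Section Problem.
Context {R : realType} (P : problem R).

Definition mu (z : R[i]) : R[i] :=
  - (z * (eta P)%:C - (xi P)%:C
     - \sum_(i < N P) (bv P i 0 ^+ 2)%:C / (z - (cv P i 0)%:C)).

Definition nu (z : R[i]) : R[i] :=
  z * (kappa P)%:C + (zeta P)%:C
  - \sum_(j < M P) (av P j 0 ^+ 2)%:C / (z - (dv P j 0)%:C).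

Record standing : Prop := Standing {
  lenA_gt0 : 0 < lenA P;
  lenB_gt0 : 0 < lenB P;
  q_L2 : L2 (- lenA P) (lenB P) (q P);
  alpha_range : 0 <= alpha P < pi;
  beta_range : 0 < beta P <= pi;
  eta_ge0 : 0 <= eta P;
  kappa_ge0 : 0 <= kappa P;
  cv_incr : increasing (cv P);
  dv_incr : increasing (dv P);
  bv_gt0 : forall i, 0 < bv P i 0;
  av_gt0 : forall j, 0 < av P j 0;
  mu_inv : 0 < eta P ->
    [/\ (0 < N1 P)%N, increasing (gammav P), forall i, 0 < betav P i 0 &
      forall z, off (cv P) z -> mu z != 0 ->
        (mu z)^-1 = (sigma P)%:C
          - \sum_(i < N1 P) (betav P i 0 ^+ 2)%:C / (z - (gammav P i 0)%:C)];
  nu_inv : 0 < kappa P ->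
    [/\ (0 < M1 P)%N, increasing (deltav P), forall j, 0 < alphav P j 0 &
      forall z, off (dv P) z -> nu z != 0 ->
        (nu z)^-1 = (tau P)%:C
          + \sum_(j < M1 P) (alphav P j 0 ^+ 2)%:C / (z - (deltav P j 0)%:C)] }.

(* The case distinctions eta > 0 / eta = 0 and kappa > 0 / kappa = 0: N^*, M^*,
   the coupling vectors (beta or b, alpha or a) and the diagonals (gamma or c,
   delta or d). *)
Definition Nstar : nat := if 0 < eta P then N1 P else N P.
Definition Mstar : nat := if 0 < kappa P then M1 P else M P.
Definition wt1 : 'cV[R]_Nstar := sel (0 < eta P) (betav P) (bv P).
Definition dg1 : 'cV[R]_Nstar := sel (0 < eta P) (gammav P) (cv P).
Definition wt2 : 'cV[R]_Mstar := sel (0 < kappa P) (alphav P) (av P).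
Definition dg2 : 'cV[R]_Mstar := sel (0 < kappa P) (deltav P) (dv P).

(* Vectors of L^2(-a,b) + C^(N^* ) + C^(M^* ), the first component being given by
   a representative: membership is [inH] and equality of vectors is [eqH]. *)
Record vecH := VecH {
  fn : R -> R[i]; bd1 : 'cV[R[i]]_Nstar; bd2 : 'cV[R[i]]_Mstar }.

Definition inH (Y : vecH) : Prop := L2 (- lenA P) (lenB P) (fn Y).

Definition eqH (Y Z : vecH) : Prop :=
  [/\ ae_eq_on (- lenA P) (lenB P) (fn Y) (fn Z),
      bd1 Y = bd1 Z & bd2 Y = bd2 Z].

Definition zeroH : vecH := VecH (fun=> 0) 0 0.
Definition scaleH (z : R[i]) (Y : vecH) : vecH :=
  VecH (fun x => z * fn Y x) (z *: bd1 Y) (z *: bd2 Y).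
Definition subH (Y Z : vecH) : vecH :=
  VecH (fun x => fn Y x - fn Z x) (bd1 Y - bd1 Z) (bd2 Y - bd2 Z).

Definition jump (y : R -> R[i]) : R[i] := limR y 0 - limL y 0.
Definition jump' (y : R -> R[i]) : R[i] := jump (derivC y).

Definition tr1 (y : R -> R[i]) : R[i] :=
  if 0 < eta P then jump' y else limR y 0.
Definition tr2 (y : R -> R[i]) : R[i] :=
  if 0 < kappa P then jump y else limL (derivC y) 0.

Definition transfer1 (y : R -> R[i]) (y1 : 'cV[R[i]]_Nstar) : Prop :=
  if 0 < eta P
  then - limR y 0 + (sigma P)%:C * jump' y - dot y1 (vecC wt1) = 0
  else jump' y - (xi P)%:C * limR y 0 - dot y1 (vecC wt1) = 0.

Definition transfer2 (y : R -> R[i]) (y2 : 'cV[R[i]]_Mstar) : Prop :=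
  if 0 < kappa P
  then limL (derivC y) 0 - (tau P)%:C * jump y - dot y2 (vecC wt2) = 0
  else - jump y + (zeta P)%:C * limL (derivC y) 0 - dot y2 (vecC wt2) = 0.

Definition regular_on (l r : R) (y : R -> R[i]) : Prop :=
  [/\ L2 l r y, L2 l r (derivC y) & exists2 w, is_ell (q P) l r y w & L2 l r w].

(* The domain of L, for the representative that is regular off 0. *)
Definition domL (Y : vecH) : Prop :=
  [/\ inH Y, regular_on (- lenA P) 0 (fn Y) & regular_on 0 (lenB P) (fn Y)] /\
  [/\ limR (fn Y) (- lenA P) * (cos (alpha P))%:C
        = limR (derivC (fn Y)) (- lenA P) * (sin (alpha P))%:C,
      limL (fn Y) (lenB P) * (cos (beta P))%:C
        = limL (derivC (fn Y)) (lenB P) * (sin (beta P))%:C,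
      transfer1 (fn Y) (bd1 Y) & transfer2 (fn Y) (bd2 Y)].

(* [Y] is in the domain of L and [L Y = Z] in the Hilbert space. *)
Definition graphL (Y Z : vecH) : Prop :=
  inH Y /\ exists Y0 : vecH,
    [/\ eqH Y Y0, domL Y0 & inH Z] /\
    [/\ is_ell (q P) (- lenA P) 0 (fn Y0) (fn Z),
        is_ell (q P) 0 (lenB P) (fn Y0) (fn Z),
        bd1 Z = tr1 (fn Y0) *: vecC wt1 + diagC dg1 *m bd1 Y0 &
        bd2 Z = tr2 (fn Y0) *: vecC wt2 + diagC dg2 *m bd2 Y0].

Definition eigenvalueL (z : R[i]) : Prop :=
  exists Y, ~ eqH Y zeroH /\ graphL Y (scaleH z Y).

(* [F] is in the domain of L and [(z - L) F = H]. *)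
Definition resolventL (z : R[i]) (H F : vecH) : Prop :=
  exists2 Z, graphL F Z & eqH (subH (scaleH z F) Z) H.

(* Initial values at -a and b are one-sided limits; y' is [derivC y]. *)
Definition is_uminus (z : R[i]) (y : R -> R[i]) : Prop :=
  [/\ is_ell (q P) (- lenA P) 0 y (fun x => z * y x),
      (y t : R[i]^o) @[t --> (- lenA P)^'+] --> ((sin (alpha P))%:C : R[i]^o) &
      (derivC y t : R[i]^o) @[t --> (- lenA P)^'+]
        --> ((cos (alpha P))%:C : R[i]^o)].

Definition is_vplus (z : R[i]) (y : R -> R[i]) : Prop :=
  [/\ is_ell (q P) 0 (lenB P) y (fun x => z * y x),
      (y t : R[i]^o) @[t --> (lenB P)^'-] --> ((sin (beta P))%:C : R[i]^o) &
      (derivC y t : R[i]^o) @[t --> (lenB P)^'-]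
        --> ((cos (beta P))%:C : R[i]^o)].

Definition pvec (z : R[i]) : 'cV[R[i]]_Nstar :=
  (if 0 < eta P then mu z else 1) *: (invmx (z%:M - diagC dg1) *m vecC wt1).

Definition qvec (z : R[i]) : 'cV[R[i]]_Mstar :=
  (if 0 < kappa P then nu z else 1) *: (invmx (z%:M - diagC dg2) *m vecC wt2).

(* In [Dfun], [Lambda] and [coefAB], [u z] and [v z] are u_- and v_+ at the
   spectral parameter [z]. *)
Definition Dfun (u v : R[i] -> R -> R[i]) (z : R[i]) : R[i] :=
  limL (derivC (u z)) 0 * limR (v z) 0
  - (limR (derivC (v z)) 0 - mu z * limR (v z) 0)
    * (limL (u z) 0 + nu z * limL (derivC (u z)) 0).

Definition Lambda (u v : R[i] -> R -> R[i]) (z : R[i]) : 'M[R[i]]_2 :=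
  (Dfun u v z)^-1 *:
  mx2 (- limR (v z) 0) (- limR (derivC (v z)) 0 + mu z * limR (v z) 0)
      (- limL (u z) 0 - nu z * limL (derivC (u z)) 0) (- limL (derivC (u z)) 0).

Definition coefAB (u v : R[i] -> R -> R[i])
    (h1 : 'cV[R[i]]_Nstar) (h2 : 'cV[R[i]]_Mstar) (z : R[i]) : 'cV[R[i]]_2 :=
  Lambda u v z *m col2 (dot h1 (pvec z)) (dot h2 (qvec z)).

(* The points where a factor of [coefAB] is undefined: the poles of mu and nu
   and the singularities of the inverses in [pvec] and [qvec]. *)
Definition nonpole (z : R[i]) : Prop :=
  [/\ off (cv P) z, off (dv P) z, off dg1 z & off dg2 z].

Definition chiAB (A B : R[i]) (u v : R -> R[i]) (x : R) : R[i] :=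
  A * (\1_(`[- lenA P, 0[) x)%:C * u x + B * (\1_(`]0, lenB P]) x)%:C * v x.

End Problem.

(* Main.v *)
Require Import Defs.
From mathcomp Require Import all_boot all_order all_algebra.
From mathcomp Require Import all_classical all_reals all_analysis.
From mathcomp Require Import complex.
From mathcomp Require Import measurable_realfun ring lra.
Import Order.TTheory GRing.Theory Num.Theory.
Import numFieldNormedType.Exports.
Local Open Scope classical_set_scope.
Local Open Scope complex_scope.
Local Open Scope ring_scope.

(** The vector sought has first component A u_- on (-a,0) and B v_+ on (0,b), so it solves
    the differential equation with parameter lam and satisfies the conditions at -a and b
    whatever A and B are. What is left of (lam - L) F = H is a square linear system for A, B
    and the finite-dimensional components f1, f2: the two transfer conditions and the two
    vector equations ([interface], [sysmx]). A solution of the homogeneous system is a vector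
    in the kernel of lam - L; since lam is not an eigenvalue and neither u_- nor v_+ vanishes
    almost everywhere, the system is injective, hence invertible ([smx_unit]). This gives
    existence at every lam, poles included, and uniqueness holds because two preimages differ
    by an element of the kernel ([resolvent_uniq]).

    Off the poles f1 and f2 can be eliminated. If eta = 0 the first transfer condition then
    reads y'(0+) - y'(0-) - mu y(0+) = <h1, p>, and if eta > 0 it takes this form after
    multiplication by mu, because the eliminated component contributes the partial fractions
    of 1 / mu. The second condition gives nu in the same way. The result is a 2 x 2 system
    with determinant D whose solution is Lambda (<h1, p>, <h2, q>) ([coefAB_iface]). A zero of
    D would produce an element of the kernel of the full system ([Dfun_neq0]). That mu, for
    positive eta, vanishes exactly at the poles of its reciprocal expansion follows from the expansion of
    1 / mu at nonreal points, where the imaginary part of mu is not 0 ([nevan_neq0],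
    [nevan_eq0]).

    At a pole no residues have to be computed: the full system has entries that are continuous
    in the spectral parameter, and it is invertible at lam. By Cramer's rule its solution, and
    with it the pair given by the formula at nearby points, tends to the solution at lam.

    Two analytic facts enter. The one-sided limits of u_-, v_+ and of the functions in the
    domain of L exist, together with those of their derivatives, and for u_- and v_+ they
    depend continuously on the spectral parameter. Both follow from Gronwall's inequality
    ([subsol_bound]): q is integrable, so the energy |y| + |y'| can at most double over steps
    of a fixed small length ([growth]). *)

Set Implicit Arguments.
Unset Strict Implicit.
Unset Printing Implicit Defensive.

(* The name also denotes the derivative of a constant polynomial. *)
Local Notation derivC := Defs.derivC.

(** * Complex-valued limits *)

Section ComplexTopology.
Context {R : realType}.
Implicit Types (z w : R[i]).

(** Derivatives and integrals of complex functions are taken componentwise; the sum norm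
    of the components is compatible with both and submultiplicative. *)
Definition n1 z : R := `|complex.Re z| + `|complex.Im z|.

Lemma n1_ge0 z : 0 <= n1 z.
Proof. by rewrite addr_ge0. Qed.

Lemma Re_le_n1 z : `|complex.Re z| <= n1 z.
Proof. by rewrite lerDl. Qed.

Lemma Im_le_n1 z : `|complex.Im z| <= n1 z.
Proof. by rewrite lerDr. Qed.

Lemma n1_eq0 z : n1 z = 0 -> z = 0.
Proof.
move=> /eqP; rewrite paddr_eq0// !normr_eq0 => /andP[/eqP a /eqP b].
by apply/eqP; rewrite eq_complex a b !eqxx.
Qed.

Lemma n1D z w : n1 (z + w) <= n1 z + n1 w.
Proof. by case: z w => [a b] [c d]; rewrite /n1 /= addrACA lerD ?ler_normD. Qed.

Lemma n1N z : n1 (- z) = n1 z.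
Proof. by case: z => a b; rewrite /n1 /= !normrN. Qed.

Lemma n1M z w : n1 (z * w) <= n1 z * n1 w.
Proof.
case: z w => [a b] [c d]; rewrite /n1 /=.
apply: (@le_trans _ _ ((`|a| * `|c| + `|b| * `|d|) + (`|a| * `|d| + `|b| * `|c|))).
  by apply: lerD; rewrite -!normrM; [apply: ler_normB|apply: ler_normD].
by rewrite (_ : _ + _ = (`|a| + `|b|) * (`|c| + `|d|))//; ring.
Qed.

Lemma norm_le_n1 z : `|z| <= (n1 z)%:C.
Proof.
rewrite {1}[z]complexE (le_trans (ler_normD _ _))// rmorphD/= lerD//.
  by rewrite normc_def/= expr0n addr0 sqrtr_sqr.
by rewrite normc_def/= !mul0r mul1r subrr expr0n !add0r sqrtr_sqr ?mul1r.
Qed.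

Lemma normc_ge_Im z : `|complex.Im z|%:C <= `|z|.
Proof.
case: z => a b; rewrite normc_def /= lecR -sqrtr_sqr ler_sqrt.
  by rewrite lerDr sqr_ge0.
by rewrite addr_ge0 ?sqr_ge0.
Qed.

Definition cvgC {T : Type} (F : set_system T) (f : T -> R[i]) (l : R[i]) : Prop :=
  (f t : R[i]^o) @[t --> F] --> (l : R[i]^o).

Lemma cvgCE {T : Type} (F : set_system T) (f : T -> R[i]) l :
  cvgC F f l = ((f t : R[i]^o) @[t --> F] --> (l : R[i]^o)).
Proof. by []. Qed.

Lemma cvgC_ReIm {T : Type} (F : set_system T) {FF : Filter F} (f : T -> R[i]) l :
  cvgC F f l <->
  (complex.Re (f t) @[t --> F] --> complex.Re l) /\
  (complex.Im (f t) @[t --> F] --> complex.Im l).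
Proof.
split=> [/cvgrPdist_lt h|[/cvgrPdist_lt hr /cvgrPdist_lt hi]].
- split; apply/cvgrPdist_lt => e e0.
  + have /h : 0 < e%:C :> R[i] by rewrite ltcR.
    apply: filterS => t; rewrite -ltcR => /(le_lt_trans _); apply.
    by have := normc_ge_Re (l - f t); rewrite raddfB.
  + have /h : 0 < e%:C :> R[i] by rewrite ltcR.
    apply: filterS => t; rewrite -ltcR => /(le_lt_trans _); apply.
    by have := normc_ge_Im (l - f t); rewrite raddfB.
- apply/cvgrPdist_lt => -[e e']; rewrite ltcE /= => /andP[/eqP -> e0].
  have e20 : 0 < e / 2 by rewrite divr_gt0.
  have := hi _ e20; have := hr _ e20; apply: filterS2 => t h1 h2.
  apply: le_lt_trans (norm_le_n1 _) _; rewrite ltcR /n1 !raddfB/= (splitr e).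
  exact: ltrD.
Qed.

Lemma cvgC_n1 {T : Type} (F : set_system T) {FF : Filter F} (f : T -> R[i]) l :
  cvgC F f l <-> forall e : R, 0 < e -> \forall t \near F, n1 (l - f t) < e.
Proof.
rewrite cvgC_ReIm; split=> [[/cvgrPdist_lt hr /cvgrPdist_lt hi] e e0|h].
  have e20 : 0 < e / 2 by rewrite divr_gt0.
  have := hi _ e20; have := hr _ e20; apply: filterS2 => t h1 h2.
  by rewrite /n1 !raddfB/= (splitr e) ltrD.
split; apply/cvgrPdist_lt => e /h; apply: filterS => t; apply: le_lt_trans.
  by rewrite -raddfB Re_le_n1.
by rewrite -raddfB Im_le_n1.
Qed.

Lemma hausC : hausdorff_space R[i]^o.
Proof. exact: norm_hausdorff. Qed.

Lemma cvgC_lim {T : Type} (F : set_system T) {FF : ProperFilter F} (f : T -> R[i]) l :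
  cvgC F f l -> lim ((f t : R[i]^o) @[t --> F]) = l.
Proof. exact: (cvg_lim hausC). Qed.

Lemma cvgC_uniq {T : Type} (F : set_system T) {FF : ProperFilter F} (f : T -> R[i]) l m :
  cvgC F f l -> cvgC F f m -> l = m.
Proof. by move=> /cvgC_lim <- /cvgC_lim. Qed.

Section Ops.
Context {T : Type} (F : set_system T) {FF : Filter F}.
Implicit Types f g : T -> R[i].

Lemma cvgC_cst l : cvgC F (fun=> l) l.
Proof. exact: cvg_cst. Qed.
Lemma cvgCD f g l m : cvgC F f l -> cvgC F g m -> cvgC F (fun t => f t + g t) (l + m).
Proof. exact: cvgD. Qed.
Lemma cvgCB f g l m : cvgC F f l -> cvgC F g m -> cvgC F (fun t => f t - g t) (l - m).
Proof. exact: cvgB. Qed.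
Lemma cvgCN f l : cvgC F f l -> cvgC F (fun t => - f t) (- l).
Proof. exact: cvgN. Qed.
Lemma cvgCM f g l m : cvgC F f l -> cvgC F g m -> cvgC F (fun t => f t * g t) (l * m).
Proof. exact: cvgM. Qed.
Lemma cvgCV f l : l != 0 -> cvgC F f l -> cvgC F (fun t => (f t)^-1) (l^-1).
Proof. by move=> l0 h; apply: (cvgV l0 h). Qed.
Lemma cvgC_sum (I : Type) (r : seq I) (Q : pred I) (f : I -> T -> R[i]) l :
  (forall i, Q i -> cvgC F (f i) (l i)) ->
  cvgC F (fun t => \sum_(i <- r | Q i) f i t) (\sum_(i <- r | Q i) l i).
Proof.
move=> h; elim: r => [|i r ih].
  rewrite big_nil; under [X in cvgC _ X]eq_fun do rewrite big_nil; exact: cvgC_cst.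
rewrite big_cons; under [X in cvgC _ X]eq_fun do rewrite big_cons.
case: ifP => Qi; last exact: ih.
exact: cvgCD (h _ Qi) ih.
Qed.
Lemma cvgC_prod (I : Type) (r : seq I) (Q : pred I) (f : I -> T -> R[i]) l :
  (forall i, Q i -> cvgC F (f i) (l i)) ->
  cvgC F (fun t => \prod_(i <- r | Q i) f i t) (\prod_(i <- r | Q i) l i).
Proof.
move=> h; elim: r => [|i r ih].
  rewrite big_nil; under [X in cvgC _ X]eq_fun do rewrite big_nil; exact: cvgC_cst.
rewrite big_cons; under [X in cvgC _ X]eq_fun do rewrite big_cons.
case: ifP => Qi; last exact: ih.
exact: cvgCM (h _ Qi) ih.
Qed.
Lemma cvgC_near f g l : {near F, f =1 g} -> cvgC F f l -> cvgC F g l.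
Proof.
move=> fg h; apply: cvg_trans h; apply: near_eq_cvg.
by apply: filterS fg => t ->.
Qed.
End Ops.

(** Completeness of the reals, applied to each component. *)
Lemma cauchyC {T : Type} (F : set_system T) {FF : ProperFilter F} (f : T -> R[i]) :
  (forall e : R, 0 < e -> exists2 A, F A & forall s t, A s -> A t -> n1 (f s - f t) < e) ->
  exists l, cvgC F f l.
Proof.
move=> h.
have key (p : {additive R[i] -> R}) : (forall z, `|p z| <= n1 z) ->
    exists l, p (f t) @[t --> F] --> (l : R).
  move=> pn; suff /cvg_ex[l hl] : cvg (p (f t) @[t --> F]) by exists l.
  apply/cauchy_cvgP/cauchyP => e e0; have [A FA hA] := h _ e0.
  have [s As] := filter_ex FA; exists (p (f s)).
  rewrite /fmap /=; apply: filterS FA => t At.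
  by rewrite /ball /= -raddfB (le_lt_trans (pn _))// hA.
have [a ha] := key _ Re_le_n1; have [b hb] := key _ Im_le_n1.
by exists (a +i* b); apply/cvgC_ReIm.
Qed.

End ComplexTopology.
(* Sealed, so that unification compares limits of functions and not filters. *)
Local Opaque cvgC.

(** * Integrals and square integrable functions *)

Section Integrals.
Context {R : realType}.
Notation mu := (@lebesgue_measure R).
Implicit Types (f g h : R -> R) (l r : R) (D : set R).

Lemma aeS (A B : R -> Prop) : (forall x, A x -> B x) ->
  {ae mu, forall x : R, A x} -> {ae mu, forall x : R, B x}.
Proof. exact: (@filterS _ _ (ae_filter_ringOfSetsType mu)). Qed.

Lemma aeI (A B : R -> Prop) : {ae mu, forall x : R, A x} ->
  {ae mu, forall x : R, B x} -> {ae mu, forall x : R, A x /\ B x}.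
Proof. exact: (@filterI _ _ (ae_filter_ringOfSetsType mu)). Qed.

Lemma aeT (A : R -> Prop) : (forall x, A x) -> {ae mu, forall x : R, A x}.
Proof.
move=> h; apply: (@aeS setT) => //.
exact: (@filterT _ _ (ae_filter_ringOfSetsType mu)).
Qed.

Lemma Rint_le_ae D f h : (R.-ocitv.-measurable).-sigma.-measurable D ->
  mu.-integrable D (EFin \o f) -> mu.-integrable D (EFin \o h) ->
  (forall x, D x -> 0 <= h x) ->
  {ae mu, forall x, D x -> `|f x| <= h x} ->
  `|\int[mu]_(x in D) f x| <= \int[mu]_(x in D) h x.
Proof.
move=> mD fi hi h0 fh.
have := @le_normr_Rintegral _ _ R mu D f mD fi.
move/le_trans; apply.
have fi' := integrable_norm fi.
apply: fine_le.
- exact: (integrable_fin_num mD fi').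
- exact: (integrable_fin_num mD hi).
- apply: ae_ge0_le_integral => //; first by case/integrableP : fi'.
  by case/integrableP : hi.
Qed.

(** One step length serves the whole interval: this is what allows Gronwall's argument to
    be run in finitely many equal steps although the coefficient is only integrable. *)
Lemma integral_modulus l r h : mu.-integrable `]l, r[ (EFin \o h) ->
  forall e, 0 < e -> exists2 d, 0 < d & forall x y, l < x -> x <= y -> y < r ->
    y - x < d -> \int[mu]_(t in `[x, y]) `|h t| < e.
Proof.
move=> ih e e0.
have : mu.-integrable setT (EFin \o h \_ `]l, r[).
  by rewrite -restrict_EFin; apply/(proj1 (integrable_mkcond (mu := mu) _ _) ih).
move=> /integral_normr_continuous /(_ _ e0)[d [d0 hd]].
exists d => // x y lx xy yr xyd.
have : \int[mu]_(t in `[x, y]) `|(h \_ `]l, r[) t| < e.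
  apply: hd => //; rewrite [ltLHS](lebesgue_measure_itv `[x, y])/=.
  by case: ifP => _; rewrite ?lte_fin // -EFinB lte_fin.
congr (_ < _); apply: eq_Rintegral => t; rewrite inE/= in_itv/= => /andP[xt ty].
by rewrite patchE mem_set//= in_itv/= (lt_le_trans lx)// (le_lt_trans ty).
Qed.

Lemma integrable_sub l r x y h : mu.-integrable `]l, r[ (EFin \o h) ->
  l < x -> y < r -> mu.-integrable `[x, y] (EFin \o h).
Proof.
move=> ih lx yr; apply: integrableS ih => // t /=; rewrite !in_itv/= => /andP[a b].
by rewrite (lt_le_trans lx)// (le_lt_trans b).
Qed.

Lemma LfunP2 D f : (R.-ocitv.-measurable).-sigma.-measurable D ->
  (f \_ D \in Lfun mu 2%:E) <->
  measurable_fun D f /\ mu.-integrable D (EFin \o (fun x => f x ^+ 2)).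
Proof.
move=> mD; split=> [h|[mf i2]].
- split.
    apply: (proj2 (measurable_restrictT f mD)).
    by have := sub_Lfun_mfun h; rewrite inE.
  apply: (proj2 (integrable_mkcond (mu := mu) _ mD)); rewrite restrict_EFin.
  have := Lfun2_integrable_sqr h.
  congr (integrable _ _ (EFin \o _)); apply/funext => x.
  by rewrite !patchE; case: ifP => // _; rewrite /point/= expr0n.
- have mr : measurable_fun setT (f \_ D) by apply: (proj1 (measurable_restrictT f mD)).
  apply/andP; split; rewrite inE//= /finite_norm unlock poweR_lty//.
  rewrite (_ : integral _ _ _ = \int[mu]_(x in D) (f x ^+ 2)%:E)%E.
    rewrite integrable_lty//.
  rewrite [RHS]integral_mkcond; apply: eq_integral => x _.
  rewrite /= !patchE; case: ifP => _.
    by rewrite powR_mulrn ?real_normK ?num_real ?normr_ge0.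
  by rewrite /point/= normr0 powR0.
Qed.

Lemma L2E l r (y : R -> R[i]) : L2 l r y <->
  [/\ measurable_fun `]l, r[ (fun t => complex.Re (y t)),
      measurable_fun `]l, r[ (fun t => complex.Im (y t)) &
      mu.-integrable `]l, r[ (EFin \o (fun t => n1 (y t) ^+ 2))].
Proof.
have mI : (R.-ocitv.-measurable).-sigma.-measurable (`]l, r[%classic : set R) by [].
rewrite /L2 !(LfunP2 _ mI); split=> [[[m1 i1] [m2 i2]]|[m1 m2 i]].
- split=> //.
  have := integrableD mI (integrableZl mI 2%R i1) (integrableZl mI 2%R i2).
  apply: le_integrable => //.
    apply/measurable_EFinP; apply: measurable_funX.
    by apply: measurable_funD; apply: measurableT_comp.
  move=> x _ ; rewrite /comp -!EFinM -EFinD !abse_EFin lee_fin.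
  rewrite ger0_norm ?sqr_ge0// ger0_norm; last first.
    by rewrite addr_ge0// mulr_ge0// sqr_ge0.
  rewrite -(real_normK (num_real (complex.Re (y x)))).
  rewrite -(real_normK (num_real (complex.Im (y x)))) /n1.
  by have := sqr_ge0 (`|complex.Re (y x)| - `|complex.Im (y x)|); nra.
- split; split=> //; apply: le_integrable i => //.
  + by apply/measurable_EFinP; apply: measurable_funX.
  + move=> x _ /=; rewrite lee_fin !ger0_norm ?sqr_ge0//.
    by rewrite -[X in X <= _]real_normK ?num_real// lerXn2r ?nnegrE ?n1_ge0 ?Re_le_n1.
  + by apply/measurable_EFinP; apply: measurable_funX.
  + move=> x _ /=; rewrite lee_fin !ger0_norm ?sqr_ge0//.
    by rewrite -[X in X <= _]real_normK ?num_real// lerXn2r ?nnegrE ?n1_ge0 ?Im_le_n1.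
Qed.

Lemma measurable_n1 D (y : R -> R[i]) :
  measurable_fun D (fun t => complex.Re (y t)) ->
  measurable_fun D (fun t => complex.Im (y t)) -> measurable_fun D (fun t => n1 (y t)).
Proof. by move=> mr mi; apply: measurable_funD; apply: measurableT_comp. Qed.

(** The closure properties of [L2] reduce to domination, because multiplication by a
    complex scalar mixes the real and imaginary parts. *)
Lemma L2_dom l r (c : R) (y f g : R -> R[i]) :
  measurable_fun `]l, r[ (fun t => complex.Re (y t)) ->
  measurable_fun `]l, r[ (fun t => complex.Im (y t)) ->
  (forall x, x \in `]l, r[ -> n1 (y x) <= c * (n1 (f x) + n1 (g x))) ->
  L2 l r f -> L2 l r g -> L2 l r y.
Proof.
move=> m1 m2 dom /L2E[_ _ i1] /L2E[_ _ i2]; apply/L2E; split=> //.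
have mI : (R.-ocitv.-measurable).-sigma.-measurable (`]l, r[%classic : set R) by [].
have := integrableZl mI (2 * c ^+ 2)%R (integrableD mI i1 i2).
apply: le_integrable => //.
  by apply/measurable_EFinP; apply: measurable_funX; apply: measurable_n1.
move=> x xI; rewrite /comp -EFinD -EFinM !abse_EFin lee_fin.
rewrite ger0_norm ?sqr_ge0// ger0_norm; last first.
  by do ![apply: sqr_ge0|apply: addr_ge0|apply: mulr_ge0|].
have := dom _ xI; have := n1_ge0 (y x).
set a := n1 (f x); set b := n1 (g x) => y0 hy.
apply: (@le_trans _ _ ((c * (a + b)) ^+ 2)).
  by rewrite lerXn2r ?nnegrE// (le_trans y0).
rewrite exprMn (mulrC 2%R) -[leRHS]mulrA ler_wpM2l ?sqr_ge0//.
by have := sqr_ge0 (a - b); nra.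
Qed.

Lemma L2_measurable l r (y : R -> R[i]) : L2 l r y ->
  measurable_fun `]l, r[ (fun t => complex.Re (y t)) /\
  measurable_fun `]l, r[ (fun t => complex.Im (y t)).
Proof. by move=> /L2E[]. Qed.

Lemma integrable_cst_itv l r (k : R) : mu.-integrable `]l, r[ (EFin \o (fun=> k)).
Proof.
apply: measurable_bounded_integrable => //; last exact: bounded_cst.
rewrite [ltLHS](lebesgue_measure_itv `]l, r[)/=.
by case: ifP => // _; rewrite -EFinB ltry.
Qed.

Lemma L2_cst l r (c : R[i]) : L2 l r (fun=> c).
Proof.
by apply/L2E; split=> //; exact: integrable_cst_itv.
Qed.

Lemma L2_sub l r (f g : R -> R[i]) : L2 l r f -> L2 l r g -> L2 l r (fun x => f x - g x).
Proof.
move=> hf hg; have [a b] := L2_measurable hf; have [c d] := L2_measurable hg.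
apply: (L2_dom (c := 1) _ _ _ hf hg).
- rewrite (_ : (fun t => _) = (fun t => complex.Re (f t) - complex.Re (g t))).
    exact: measurable_funB.
  by apply/funext => t; case: (f t) (g t) => [? ?] [? ?].
- rewrite (_ : (fun t => _) = (fun t => complex.Im (f t) - complex.Im (g t))).
    exact: measurable_funB.
  by apply/funext => t; case: (f t) (g t) => [? ?] [? ?].
- by move=> x _; rewrite mul1r (le_trans (n1D _ _))// n1N.
Qed.

Lemma L2_scale l r (k : R[i]) (f : R -> R[i]) : L2 l r f -> L2 l r (fun x => k * f x).
Proof.
move=> hf; have [a b] := L2_measurable hf.
apply: (L2_dom (c := n1 k) _ _ _ hf (L2_cst l r 0)).
- rewrite (_ : (fun t => _) = (fun t => complex.Re k * complex.Re (f t) -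
    complex.Im k * complex.Im (f t))).
    by apply: measurable_funB; apply: measurable_funM.
  by apply/funext => t; case: k (f t) => [? ?] [? ?].
- rewrite (_ : (fun t => _) = (fun t => complex.Re k * complex.Im (f t) +
    complex.Im k * complex.Re (f t))).
    by apply: measurable_funD; apply: measurable_funM.
  by apply/funext => t; case: k (f t) => [? ?] [? ?].
- by move=> x _; rewrite [n1 0]/n1/= !normr0 !addr0 n1M.
Qed.

Lemma L2_eq l r (f g : R -> R[i]) : (forall x, x \in `]l, r[ -> f x = g x) ->
  L2 l r f -> L2 l r g.
Proof.
move=> fg /L2E[a b c]; apply/L2E; split.
- by apply: eq_measurable_fun a => x; rewrite inE/= => xI; rewrite fg.
- by apply: eq_measurable_fun b => x; rewrite inE/= => xI; rewrite fg.
- by apply: eq_integrable c => //= x; rewrite inE/= => xI; rewrite fg.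
Qed.

Lemma L2_itvS l r l' r' (f : R -> R[i]) : l <= l' -> r' <= r -> L2 l r f -> L2 l' r' f.
Proof.
move=> ll rr /L2E[a b c].
have S : (`]l', r'[ `<=` `]l, r[)%classic.
  move=> t /=; rewrite !in_itv/= => /andP[? ?].
  by rewrite (le_lt_trans ll)//= (lt_le_trans _ rr).
apply/L2E; split.
- exact: measurable_funS a.
- exact: measurable_funS b.
- exact: integrableS c.
Qed.

Lemma L2_bounded l r (f : R -> R[i]) (B : R) :
  (forall x, x \in `]l, r[ -> {for x, continuous (fun t => complex.Re (f t))}) ->
  (forall x, x \in `]l, r[ -> {for x, continuous (fun t => complex.Im (f t))}) ->
  (forall x, x \in `]l, r[ -> n1 (f x) <= B) -> L2 l r f.
Proof.
move=> cr ci fB; apply: (L2_dom (c := B) _ _ _ (L2_cst l r 1) (L2_cst l r 0)).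
- apply: open_continuous_measurable_fun => //.
  by move=> x; rewrite inE/=; exact: cr.
- apply: open_continuous_measurable_fun => //.
  by move=> x; rewrite inE/=; exact: ci.
- by move=> x xI; rewrite /n1 /= normr1 !normr0 !addr0 mulr1; exact: fB.
Qed.

Lemma L2_glue l m r (f : R -> R[i]) : l < m -> m < r ->
  L2 l m f -> L2 m r f -> f m = 0 -> L2 l r f.
Proof.
move=> lm mr /L2E[a b c] /L2E[a' b' c'] fm0.
have E : (`]l, r[ = `]l, m[ `|` (`]m, r[ `|` [set m]))%classic.
  apply/seteqP; split=> x /=; rewrite !in_itv/=.
    by move=> /andP[lx xr]; case: (ltgtP x m) => xm; [left|right; left|right; right]; rewrite ?lx ?xr.
  by move=> [/andP[lx xm]|[/andP[mx xr]| ->]]; rewrite ?lx ?xr ?lm ?mr ?(lt_trans xm)// ?(lt_trans lm).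
have mI : (R.-ocitv.-measurable).-sigma.-measurable (`]l, m[%classic : set R) by [].
have mJ : (R.-ocitv.-measurable).-sigma.-measurable (`]m, r[%classic : set R) by [].
have mF (h : R -> R) : measurable_fun `]l, m[ h -> measurable_fun `]m, r[ h ->
    measurable_fun `]l, r[ h.
  move=> h1 h2; rewrite E; apply/measurable_funU => //; first exact: measurableU.
  split=> //; apply/measurable_funU => //; split=> //; exact: measurable_fun_set1.
apply/L2E; split; [exact: mF|exact: mF|].
have := integrableD measurableT (proj1 (integrable_mkcond _ mI) c) (proj1 (integrable_mkcond _ mJ) c').
move=> i; apply/integrable_mkcond => //; apply: eq_integrable i => // x _ /=.
have memI (a0 b0 t : R) : (t \in `]a0, b0[%classic) = (a0 < t < b0).
  by apply/idP/idP; rewrite inE/= in_itv.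
rewrite !patchE /point/= !memI.
case: (ltgtP x m) => [xm|mx|->] /=.
- by rewrite (lt_trans xm mr) andbT; case: ifP; rewrite adde0.
- by rewrite (lt_trans lm mx)/=; case: ifP; rewrite add0e.
- by rewrite lm mr fm0 /n1 /= !normr0 !addr0 expr0n.
Qed.

End Integrals.

(** * Discrete growth estimate *)

Section Growth.
Context {R : realType}.
Notation mu := (@lebesgue_measure R).
Implicit Types (l r : R).

Lemma L2_integrable l r (y : R -> R[i]) : L2 l r y ->
  mu.-integrable `]l, r[ (EFin \o (fun t => n1 (y t))).
Proof.
move=> /L2E[m1 m2 i].
have mI : (R.-ocitv.-measurable).-sigma.-measurable (`]l, r[%classic : set R) by [].
have /L2E[_ _ i1] := L2_cst l r (1 : R[i]).
have := integrableD mI i1 i.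
apply: le_integrable => //.
  by apply/measurable_EFinP; apply: measurable_n1.
move=> x _; rewrite /comp -EFinD !abse_EFin lee_fin.
rewrite ger0_norm ?n1_ge0// ger0_norm ?addr_ge0 ?sqr_ge0//.
rewrite {2}/n1 /= normr1 normr0 addr0 expr1n.
by have := sqr_ge0 (n1 (y x) - 1); nra.
Qed.

(** Over a step shorter than [d] with end x0 the maximum S of [N] satisfies
    S <= N x0 + c + S / 2, hence S <= 2 (N x0 + c): one step at most doubles [N + 2 c]. The constant is 2 to the
    number of steps, so it depends only on [d] and the length of the interval. *)
Lemma growth l r (d : R) : l < r -> 0 < d -> exists2 C : R, 0 <= C &
  forall (N : R -> R) (c : R), 0 <= c ->
  (forall x, x \in `]l, r[ -> 0 <= N x) ->
  (forall x, x \in `]l, r[ -> {for x, continuous N}) ->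
  (forall x1 x2 S, l < x1 -> x1 <= x2 -> x2 < r -> x2 - x1 < d ->
     (forall x, x \in `[x1, x2] -> N x <= S) -> `|N x2 - N x1| <= c + S / 2) ->
  forall x x0, x \in `]l, r[ -> x0 \in `]l, r[ -> N x <= C * (N x0 + c).
Proof.
move=> lr d0.
have [n hn] : exists n : nat, r - l < d / 2 * n%:R.
  have [n hn] : exists n : nat, (r - l) / (d / 2) < n%:R.
    by exists (Num.truncn ((r - l) / (d / 2))).+1; exact: truncnS_gt.
  by exists n; rewrite mulrC -ltr_pdivrMr// divr_gt0.
exists (2 ^+ n.+1); first by rewrite exprn_ge0.
move=> N c c0 N0 cN osc.
have step x x' : x \in `]l, r[ -> x' \in `]l, r[ -> `|x - x'| < d ->
    N x + 2 * c <= 2 * (N x' + 2 * c).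
  have main x1 x2 : x1 \in `]l, r[ -> x2 \in `]l, r[ -> x1 <= x2 -> x2 - x1 < d ->
      N x1 <= 2 * (N x2 + c) /\ N x2 <= 2 * (N x1 + c).
    rewrite !in_itv/= => /andP[lx1 x1r] /andP[lx2 x2r] x12 dx.
    have [m mI mmax] : exists2 m, m \in `[x1, x2] & forall t, t \in `[x1, x2] -> N t <= N m.
      apply: EVT_max => //; apply: continuous_in_subspaceT => t.
      rewrite inE/= in_itv/= => /andP[a b].
      by apply: cN; rewrite in_itv/= (lt_le_trans lx1)// (le_lt_trans b).
    move: (mI); rewrite in_itv/= => /andP[x1m mx2].
    have h1 : `|N m - N x1| <= c + N m / 2.
      apply: osc => //; [exact: le_lt_trans x2r|by lra|].
      move=> t; rewrite in_itv/= => /andP[a b]; apply: mmax.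
      by rewrite in_itv/= a (le_trans b).
    have h2 : `|N x2 - N m| <= c + N m / 2.
      apply: osc => //; [exact: lt_le_trans x1m|by lra|].
      move=> t; rewrite in_itv/= => /andP[a b]; apply: mmax.
      by rewrite in_itv/= b (le_trans x1m).
    have m1 : N x1 <= N m by apply: mmax; rewrite in_itv/= lexx.
    have m2 : N x2 <= N m by apply: mmax; rewrite in_itv/= lexx andbT.
    move: h1 h2; rewrite !ler_norml => /andP[_ h1] /andP[h2 _].
    by split; lra.
  move=> xI xI' dx; have [xx|/ltW xx] := leP x x'.
    have [|h _] := main _ _ xI xI' xx; last by lra.
    by move: dx; rewrite ler0_norm; lra.
  have [|_ h] := main _ _ xI' xI xx; last by lra.
  by move: dx; rewrite ger0_norm; lra.
have chain k x x0 : x \in `]l, r[ -> x0 \in `]l, r[ -> `|x - x0| <= d / 2 * k%:R ->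
    N x + 2 * c <= 2 ^+ k * (N x0 + 2 * c).
  elim: k x => [|k ih] x xI x0I.
    rewrite mulr0 normr_le0 subr_eq0 => /eqP ->; by rewrite expr0 mul1r.
  (* One step short of [x] on the segment from [x0] to [x]. *)
  move=> hx; pose x' := x0 + (x - x0) * (k%:R / k.+1%:R).
  have k1 : (0 : R) < k.+1%:R by rewrite ltr0n.
  have kk : k%:R / k.+1%:R = 1 - k.+1%:R^-1 :> R.
    by rewrite -[k.+1%:R]natr1; field; rewrite natr1 gt_eqF.
  have th0 : 0 <= k%:R / k.+1%:R :> R by rewrite divr_ge0.
  have th1 : k%:R / k.+1%:R < 1 :> R by rewrite kk gtrBl invr_gt0.
  have x'I : x' \in `]l, r[.
    move: xI x0I th0 th1; rewrite !in_itv/= /x'; set th := _ / _.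
    move=> /andP[a b] /andP[a' b'] t0 t1.
    have h1 : 0 <= th * (x - l) by rewrite mulr_ge0 // subr_ge0 ltW.
    have h2 : 0 <= th * (r - x) by rewrite mulr_ge0 // subr_ge0 ltW.
    have h3 : 0 < (1 - th) * (x0 - l) by rewrite mulr_gt0 ?subr_gt0.
    have h4 : 0 < (1 - th) * (r - x0) by rewrite mulr_gt0 ?subr_gt0.
    by apply/andP; split; lra.
  have e0 : `|x' - x0| <= d / 2 * k%:R.
    rewrite /x' addrC addKr normrM (ger0_norm th0) mulrA ler_pdivrMr// .
    by rewrite [leRHS]mulrAC ler_wpM2r.
  have e1 : `|x - x'| < d.
    rewrite (_ : x - x' = (x - x0) / k.+1%:R); last by rewrite /x' kk; ring.
    rewrite normrM normfV (ger0_norm (ltW k1)) ltr_pdivrMr//.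
    by rewrite (le_lt_trans hx)// ltr_pM2r// ltr_pdivrMr// ltr_pMr// ltr1n.
  have := step _ _ xI x'I e1; have := ih _ x'I x0I e0; rewrite exprS -mulrA; lra.
move=> x x0 xI x0I.
have : N x + 2 * c <= 2 ^+ n * (N x0 + 2 * c).
  apply: chain => //; apply: le_trans (ltW hn).
  move: xI x0I; rewrite !in_itv/= ler_norml => /andP[? ?] /andP[? ?]; lra.
have : 0 <= 2 ^+ n * N x0 :> R by rewrite mulr_ge0 ?exprn_ge0 ?N0.
by rewrite exprS -mulrA; lra.
Qed.

End Growth.

(** * Gronwall's inequality for subsolutions *)

Section Subsolutions.
Context {R : realType}.
Notation mu := (@lebesgue_measure R).
Implicit Types (l r : R) (y : R -> R[i]) (k g : R -> R).

(** All estimates use the equation only through this inequality. It holds for solutions, and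
    for the difference of solutions with neighbouring spectral parameters. *)
Definition subsol l r k g y : Prop :=
  (forall x, x \in `]l, r[ -> derivableC y x) /\
  exists2 ddy, loc_AC l r (derivC y) ddy &
    {ae mu, forall x, x \in `]l, r[ -> n1 (ddy x) <= k x * n1 (y x) + g x}.

Definition energy y (x : R) : R := n1 (y x) + n1 (derivC y x).

Lemma energy_ge0 y x : 0 <= energy y x.
Proof. by rewrite addr_ge0 ?n1_ge0. Qed.

Lemma derivableC_cvg y x : derivableC y x -> cvgC (nbhs x) y (y x).
Proof.
move=> [dr di]; apply/cvgC_ReIm; split.
  by apply: differentiable_continuous; apply/derivable1_diffP.
by apply: differentiable_continuous; apply/derivable1_diffP.
Qed.

(** The primitive of an integrable function is continuous. *)
Lemma loc_AC_cvg l r y dy x : loc_AC l r y dy -> x \in `]l, r[ ->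
  cvgC (nbhs x) y (y x).
Proof.
rewrite in_itv/= => ac /andP[lx xr].
pose a := (l + x) / 2; pose b := (x + r) / 2.
have [la ax xb br] : [/\ l < a, a < x, x < b & b < r] by rewrite /a /b; split; lra.
have [[ir ii] _] := ac a b la (ltW (lt_trans ax xb)) br.
have sub (h : R -> R) : mu.-integrable `[a, b] (EFin \o h) ->
    mu.-integrable `]a, b[ (EFin \o h).
  by apply: integrableS => // t /=; rewrite !in_itv/= => /andP[/ltW -> /ltW ->].
have key (p : {additive R[i] -> R}) :
    (forall s t, l < s -> s <= t -> t < r -> p (y t) - p (y s) =
       \int[mu]_(u in `[s, t]) p (dy u)) ->
    mu.-integrable `[a, b] (EFin \o (fun t => p (dy t))) ->
    p (y t) @[t --> x] --> p (y x).
  move=> pE ip; apply/cvgrPdist_lt => e e0.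
  have [d d0 hd] := integral_modulus (sub _ ip) e0.
  have bnd s t : a < s -> s <= t -> t < b -> t - s < d -> `|p (y t) - p (y s)| < e.
    move=> sa st tb std; rewrite pE//; [|exact: lt_trans sa|exact: lt_trans br].
    apply: le_lt_trans (hd _ _ sa st tb std).
    apply: (@le_normr_Rintegral _ _ R mu `[s, t] (fun u => p (dy u))) => //.
    by apply: integrableS ip => // u /=; rewrite !in_itv/= => /andP[su ut];
      rewrite (ltW (lt_le_trans sa su)) (ltW (le_lt_trans ut tb)).
  have : \forall t \near x, [/\ a < t, t < b, t - x < d & x - t < d].
    near=> t; split; near: t.
    - exact: lt_nbhsr.
    - exact: lt_nbhsl.
    - have : x < x + d by rewrite ltrDl.
      by move=> /lt_nbhsl; apply: filterS => t; lra.
    - have : x - d < x by rewrite gtrBl.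
      by move=> /lt_nbhsr; apply: filterS => t; lra.
  apply: filterS => t [at_ tb h1 h2].
  have [xt|tx] := leP x t; last by apply: bnd => //; exact: ltW.
  by rewrite distrC; apply: bnd.
apply/cvgC_ReIm; split.
- apply: key => // s t ls st tr.
  by rewrite -raddfB; have [_ ->] := ac s t ls st tr.
- apply: key => // s t ls st tr.
  by rewrite -raddfB; have [_ ->] := ac s t ls st tr.
Unshelve. all: by end_near.
Qed.

Lemma derivC_MVT l r y x1 x2 S : (forall x, x \in `]l, r[ -> derivableC y x) ->
  l < x1 -> x1 <= x2 -> x2 < r ->
  (forall x, x \in `[x1, x2] -> n1 (derivC y x) <= S) ->
  n1 (y x2 - y x1) <= 2 * (x2 - x1) * S.
Proof.
move=> dy lx x12 xr yS.
have key (f : R -> R) : (forall x, x \in `]l, r[ -> derivable f x 1) ->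
    (forall x, x \in `[x1, x2] -> `|f^`()%classic x| <= S) ->
    `|f x2 - f x1| <= (x2 - x1) * S.
  move=> df fS.
  have inI x : x \in `[x1, x2] -> x \in `]l, r[.
    by rewrite !in_itv/= => /andP[a b]; rewrite (lt_le_trans lx)// (le_lt_trans b).
  have [||c cI ->] := @MVT_segment R f f^`()%classic x1 x2 x12.
  - move=> x xI; rewrite derive1E; apply: DeriveDef => //.
    by apply: df; apply: inI; apply: subset_itv_oo_cc.
  - by apply: derivable_within_continuous => x /inI; exact: df.
  - by rewrite normrM mulrC (ger0_norm (x := x2 - x1)) ?subr_ge0// ler_wpM2l ?subr_ge0// fS.
rewrite /n1 !raddfB/= -mulrA mulr_natl mulr2n; apply: lerD.
  apply: (key (fun t => complex.Re (y t))) => x xI; first by case: (dy x xI).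
  by apply: le_trans (yS _ xI); exact: (Re_le_n1 (derivC y x)).
apply: (key (fun t => complex.Im (y t))) => x xI; first by case: (dy x xI).
by apply: le_trans (yS _ xI); exact: (Im_le_n1 (derivC y x)).
Qed.

Section Estimates.
Variables (l r : R) (k g : R -> R).
Hypothesis ik : mu.-integrable `]l, r[ (EFin \o k).
Hypothesis ig : mu.-integrable `]l, r[ (EFin \o g).

Lemma subsol_deriv_inc y x1 x2 S : subsol l r k g y ->
  l < x1 -> x1 <= x2 -> x2 < r ->
  (forall x, x \in `[x1, x2] -> n1 (y x) <= S) ->
  n1 (derivC y x2 - derivC y x1) <=
    2 * (S * \int[mu]_(t in `[x1, x2]) `|k t| + \int[mu]_(t in `[x1, x2]) `|g t|).
Proof.
move=> [_ [ddy ac ae]] lx x12 xr yS.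
have S0 : 0 <= S.
  by apply: le_trans (yS x1 _); rewrite ?n1_ge0// in_itv/= lexx.
have [[ir ii] ->] := ac _ _ lx x12 xr.
have mD : (R.-ocitv.-measurable).-sigma.-measurable (`[x1, x2]%classic : set R) by [].
have ik' := @integrable_norm _ _ _ mu _ _ (integrable_sub ik lx xr).
have ig' := @integrable_norm _ _ _ mu _ _ (integrable_sub ig lx xr).
have iSk : mu.-integrable `[x1, x2] (EFin \o (fun t => S * `|k t|)).
  exact: (integrableZl mD S ik').
have ih : mu.-integrable `[x1, x2] (EFin \o (fun t => S * `|k t| + `|g t|)).
  exact: (integrableD mD iSk ig').
have -> : S * \int[mu]_(t in `[x1, x2]) `|k t| + \int[mu]_(t in `[x1, x2]) `|g t|
    = \int[mu]_(t in `[x1, x2]) (S * `|k t| + `|g t|).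
  by rewrite RintegralD// RintegralZl.
have ae' : {ae mu, forall t, `[x1, x2]%classic t ->
    n1 (ddy t) <= S * `|k t| + `|g t|}.
  apply: aeS ae => t h tI; move: (tI); rewrite /= in_itv/= => /andP[a b].
  apply: le_trans (h _) _; first by rewrite in_itv/= (lt_le_trans lx)// (le_lt_trans b).
  apply: lerD; last exact: ler_norm.
  rewrite mulrC; apply: (@le_trans _ _ (n1 (y t) * `|k t|)).
    by rewrite ler_wpM2l ?n1_ge0// ler_norm.
  by rewrite ler_wpM2r ?yS.
rewrite /n1 /= mulr_natl mulr2n; apply: lerD; apply: Rint_le_ae => //.
- by move=> t _; rewrite addr_ge0 ?mulr_ge0.
- by apply: aeS ae' => t h /h; apply: le_trans; exact: Re_le_n1.
- by move=> t _; rewrite addr_ge0 ?mulr_ge0.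
- by apply: aeS ae' => t h /h; apply: le_trans; exact: Im_le_n1.
Qed.

End Estimates.

Lemma n1_dist (z w : R[i]) : `|n1 z - n1 w| <= n1 (z - w).
Proof.
rewrite ler_norml; apply/andP; split.
  by have := n1D (w - z) z; rewrite subrK -(opprB z w) n1N; lra.
by have := n1D (z - w) w; rewrite subrK; lra.
Qed.

Lemma cvgC_cont y x : cvgC (nbhs x) y (y x) -> {for x, continuous (fun t => n1 (y t))}.
Proof.
move=> /cvgC_n1 h; apply/cvgrPdist_lt => e /h; apply: filterS => t.
by apply: le_lt_trans; exact: n1_dist.
Qed.

Lemma subsol_cvg_pt l r k g y x : subsol l r k g y -> x \in `]l, r[ ->
  cvgC (nbhs x) y (y x) /\ cvgC (nbhs x) (derivC y) (derivC y x).
Proof.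
move=> [dy [ddy ac _]] xI; split; first by apply: derivableC_cvg; exact: dy.
exact: (loc_AC_cvg ac xI).
Qed.

Lemma Rint_norm_subset l r x1 x2 g : mu.-integrable `]l, r[ (EFin \o g) ->
  l < x1 -> x2 < r ->
  \int[mu]_(t in `[x1, x2]) `|g t| <= \int[mu]_(t in `]l, r[) `|g t|.
Proof.
move=> ig lx xr.
have mD : (R.-ocitv.-measurable).-sigma.-measurable (`[x1, x2]%classic : set R) by [].
have mI : (R.-ocitv.-measurable).-sigma.-measurable (`]l, r[%classic : set R) by [].
have ig' := @integrable_norm _ _ _ mu _ _ ig.
have ig'' := @integrable_norm _ _ _ mu _ _ (integrable_sub ig lx xr).
apply: fine_le.
- exact: (integrable_fin_num mD ig'').
- exact: (integrable_fin_num mI ig').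
- apply: ge0_subset_integral => //.
    by case/integrableP : ig'.
  move=> t /=; rewrite !in_itv/= => /andP[a b].
  by rewrite (lt_le_trans lx)// (le_lt_trans b).
Qed.

(** Gronwall's estimate. The constant is chosen before [y] and [g]: a family of subsolutions
    with the same [k] tends to 0 as soon as the initial energies and the forcings do. *)
Lemma subsol_bound l r k : l < r -> mu.-integrable `]l, r[ (EFin \o k) ->
  exists2 C : R, 0 <= C & forall y g, mu.-integrable `]l, r[ (EFin \o g) ->
    subsol l r k g y -> forall x x0, x \in `]l, r[ -> x0 \in `]l, r[ ->
    energy y x <= C * (energy y x0 + 2 * \int[mu]_(t in `]l, r[) `|g t|).
Proof.
move=> lr ik; have [|d d0 hd] := integral_modulus ik (e := 1 / 8); first by lra.
have d'0 : 0 < Num.min d (1 / 8) by rewrite lt_min d0; lra.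
have [C C0 hC] := growth lr d'0; exists C => // y g ig sy.
apply: hC.
- by rewrite mulr_ge0// Rintegral_ge0.
- by move=> x _; exact: energy_ge0.
- move=> x xI; have [c1 c2] := subsol_cvg_pt sy xI.
  exact: cvgD (cvgC_cont c1) (cvgC_cont c2).
move=> x1 x2 S lx x12 xr; rewrite lt_min => /andP[xd xd'] ES.
have S0 : 0 <= S by apply: le_trans (ES x1 _); rewrite ?energy_ge0// in_itv/= lexx.
have [dy _] := sy.
have h1 := derivC_MVT (S := S) dy lx x12 xr.
have h2 := subsol_deriv_inc (S := S) ik ig sy lx x12 xr.
have {}h1 : n1 (y x2 - y x1) <= 2 * (x2 - x1) * S.
  by apply: h1 => x /ES; apply: le_trans; rewrite lerDr n1_ge0.
have {h2} : n1 (derivC y x2 - derivC y x1) <=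
    2 * (S * \int[mu]_(t in `[x1, x2]) `|k t| + \int[mu]_(t in `[x1, x2]) `|g t|).
  by apply: h2 => x /ES; apply: le_trans; rewrite lerDl n1_ge0.
have := hd _ _ lx x12 xr xd; set K := \int[mu]_(t in _) `|k t| => hK.
have : \int[mu]_(t in `[x1, x2]) `|g t| <= \int[mu]_(t in `]l, r[) `|g t|.
  exact: Rint_norm_subset.
set G := \int[mu]_(t in _) `|g t|; set G' := \int[mu]_(t in _) `|g t| => GG h2.
have := n1_dist (y x2) (y x1); have := n1_dist (derivC y x2) (derivC y x1).
rewrite /energy !ler_norml => /andP[a1 a2] /andP[b1 b2].
have k1 : S * K <= S * (1 / 8) by rewrite ler_wpM2l// ltW.
have k2 : (x2 - x1) * S <= 1 / 8 * S by rewrite ler_wpM2r// ltW.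
apply/andP; split; lra.
Qed.

(** The energy is bounded, so [y] and [y'] oscillate arbitrarily little near the endpoints
    and the Cauchy criterion applies. *)
Lemma subsol_cvg l r k g y : l < r -> mu.-integrable `]l, r[ (EFin \o k) ->
  mu.-integrable `]l, r[ (EFin \o g) -> subsol l r k g y ->
  [/\ (exists2 B, 0 <= B & forall x, x \in `]l, r[ -> energy y x <= B),
     (exists a, cvgC (r^'-) y a), (exists a, cvgC (r^'-) (derivC y) a),
     (exists a, cvgC (l^'+) y a) & (exists a, cvgC (l^'+) (derivC y) a)].
Proof.
move=> lr ik ig sy; have [C C0 hC] := subsol_bound lr ik.
have {hC}[B B0 EB] : exists2 B, 0 <= B & forall x, x \in `]l, r[ -> energy y x <= B.
  have mI : (l + r) / 2 \in `]l, r[ by rewrite in_itv/=; apply/andP; split; lra.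
  exists (C * (energy y ((l + r) / 2) + 2 * \int[mu]_(t in `]l, r[) `|g t|)).
    by rewrite mulr_ge0// addr_ge0 ?energy_ge0// mulr_ge0// Rintegral_ge0.
  by move=> x xI; exact: hC.
have inI x1 x2 x : l < x1 -> x2 < r -> x \in `[x1, x2] -> x \in `]l, r[.
  by move=> lx xr; rewrite !in_itv/= => /andP[a b]; rewrite (lt_le_trans lx)// (le_lt_trans b).
have osc0 e : 0 < e -> exists2 d, 0 < d & forall s t, l < s -> s <= t -> t < r ->
    t - s < d -> n1 (y t - y s) < e /\ n1 (derivC y t - derivC y s) < e.
  (* The factor 4 leaves room for the contributions of y', [k] and [g] to sum to less than [e]. *)
  move=> e0; pose e' := e / (4 * (B + 1)).
  have e'0 : 0 < e' by rewrite divr_gt0// mulr_gt0//; lra.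
  have e'B : 4 * (e' * B) < e.
    have B1 : B + 1 != 0 by rewrite gt_eqF//; lra.
    have -> : 4 * (e' * B) = e * (B / (B + 1)) by rewrite /e'; field.
    by rewrite gtr_pMr// ltr_pdivrMr; lra.
  have [d1 d10 h1] := integral_modulus ik e'0.
  have [|d2 d20 h2] := integral_modulus ig (e := e / 4); first by rewrite divr_gt0.
  exists (Num.min e' (Num.min d1 d2)); first by rewrite !lt_min e'0 d10.
  move=> s t ls st tr; rewrite !lt_min => /and3P[de d1' d2'].
  have [dy _] := sy; split.
    have := derivC_MVT (S := B) dy ls st tr.
    move=> /(_ _)/le_lt_trans; apply.
      by move=> x xI; apply: le_trans (EB _ (inI _ _ _ ls tr xI)); rewrite lerDr n1_ge0.
    have : (t - s) * B <= e' * B by rewrite ler_wpM2r// ltW.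
    have : 0 <= e' * B by rewrite mulr_ge0// ltW.
    lra.
  have := subsol_deriv_inc (S := B) ik ig sy ls st tr.
  move=> /(_ _)/le_lt_trans; apply.
    by move=> x xI; apply: le_trans (EB _ (inI _ _ _ ls tr xI)); rewrite lerDl n1_ge0.
  have := h2 _ _ ls st tr d2'; have := h1 _ _ ls st tr d1'.
  set K := Rintegral _ _ _; set G := Rintegral _ _ _ => hK hG.
  have : B * K <= B * e' by rewrite ler_wpM2l// ltW.
  lra.
have osc e : 0 < e -> exists2 d, 0 < d & forall s t, s \in `]l, r[ -> t \in `]l, r[ ->
    `|t - s| < d -> n1 (y t - y s) < e /\ n1 (derivC y t - derivC y s) < e.
  move=> /osc0[d d0 hd]; exists d => // s t; rewrite !in_itv/= => /andP[ls sr] /andP[lt tr].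
  have [st|/ltW ts] := leP s t.
    by rewrite ger0_norm ?subr_ge0// => h; exact: hd.
  rewrite distrC ger0_norm ?subr_ge0// => h.
  by rewrite -n1N opprB -(n1N (derivC y t - _)) opprB; exact: hd.
have cauchy (F : set_system R) (FF : ProperFilter F) :
    (forall d, 0 < d -> exists2 A, F A & forall s t, A s -> A t ->
       [/\ s \in `]l, r[, t \in `]l, r[ & `|s - t| < d]) ->
    (exists a, cvgC F y a) /\ (exists a, cvgC F (derivC y) a).
  move=> h; split; apply: cauchyC => e /osc[d /h[A FA hA] hd].
    by exists A => // s t As At; have [? ? ?] := hA s t As At; case: (hd t s).
  by exists A => // s t As At; have [? ? ?] := hA s t As At; case: (hd t s).
have [hr hr'] : (exists a, cvgC (r^'-) y a) /\ (exists a, cvgC (r^'-) (derivC y) a).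
  apply: cauchy => d d0; exists [set x | [/\ l < x, r - d < x & x < r]].
    by near=> x; split; near: x; [exact: nbhs_left_gt|apply: nbhs_left_gt; lra|exact: nbhs_left_lt].
  move=> s t /= [a b c] [a' b' c']; rewrite !in_itv/= a c a' c'; split=> //.
  by rewrite ltr_norml; apply/andP; split; lra.
have [hl hl'] : (exists a, cvgC (l^'+) y a) /\ (exists a, cvgC (l^'+) (derivC y) a).
  apply: cauchy => d d0; exists [set x | [/\ l < x, x < l + d & x < r]].
    by near=> x; split; near: x; [exact: nbhs_right_gt|apply: nbhs_right_lt; lra|exact: nbhs_right_lt].
  move=> s t /= [a b c] [a' b' c']; rewrite !in_itv/= a c a' c'; split=> //.
  by rewrite ltr_norml; apply/andP; split; lra.
by split=> //; exists B.
Unshelve. all: by end_near.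
Qed.

End Subsolutions.

(** * Linear combinations under the differential expression *)

Section SturmLiouville.
Context {R : realType}.
Notation mu := (@lebesgue_measure R).
Implicit Types (l r : R) (y w q : R -> R[i]) (c : R[i]).

Lemma Re_comb c (z z' : R[i]) : complex.Re (c * z + z') =
  complex.Re c * complex.Re z - complex.Im c * complex.Im z + complex.Re z'.
Proof. by case: c z z' => [? ?] [? ?] [? ?]. Qed.

Lemma Im_comb c (z z' : R[i]) : complex.Im (c * z + z') =
  complex.Re c * complex.Im z - (- complex.Im c) * complex.Re z + complex.Im z'.
Proof. by case: c z z' => [? ?] [? ?] [? ?] /=; rewrite mulNr opprK. Qed.

Lemma is_derive_comb (a b : R) (f g h : R -> R) x :
  derivable f x 1 -> derivable g x 1 -> derivable h x 1 ->
  is_derive x 1 (fun t => a * f t - b * g t + h t)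
    (a * f^`()%classic x - b * g^`()%classic x + h^`()%classic x).
Proof.
move=> df dg dh; rewrite !derive1E.
apply: (@is_deriveD _ _ _ (fun t => a * f t - b * g t) h); last exact: derivableP.
apply: (@is_deriveB _ _ _ (fun t => a * f t) (fun t => b * g t)).
  exact: (@is_deriveZ _ _ _ f a _ _ _ (derivableP df)).
exact: (@is_deriveZ _ _ _ g b _ _ _ (derivableP dg)).
Qed.

Lemma integrable_comb (D : set R) (a b : R) (f g h : R -> R) :
  (R.-ocitv.-measurable).-sigma.-measurable D ->
  mu.-integrable D (EFin \o f) -> mu.-integrable D (EFin \o g) ->
  mu.-integrable D (EFin \o h) ->
  mu.-integrable D (EFin \o (fun t => a * f t - b * g t + h t)) /\
  \int[mu]_(t in D) (a * f t - b * g t + h t) =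
  a * \int[mu]_(t in D) f t - b * \int[mu]_(t in D) g t + \int[mu]_(t in D) h t.
Proof.
move=> mD fi gi hi.
have fi' : mu.-integrable D (EFin \o (fun t => a * f t)) := integrableZl mD a fi.
have gi' : mu.-integrable D (EFin \o (fun t => b * g t)) := integrableZl mD b gi.
have fgi : mu.-integrable D (EFin \o (fun t => a * f t - b * g t)).
  exact: (integrableB mD fi' gi').
split; first exact: (integrableD mD fgi hi).
by rewrite RintegralD// RintegralB// !RintegralZl.
Qed.

(** The combination c y1 + y2 gives sums, differences and multiples at once. *)
Lemma derivC_comb c y1 y2 x : derivableC y1 x -> derivableC y2 x ->
  derivableC (fun t => c * y1 t + y2 t) x /\
  derivC (fun t => c * y1 t + y2 t) x = c * derivC y1 x + derivC y2 x.
Proof.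
move=> [dr1 di1] [dr2 di2].
have h1 := is_derive_comb (complex.Re c) (complex.Im c) dr1 di1 dr2.
have h2 := is_derive_comb (complex.Re c) (- complex.Im c) di1 dr1 di2.
rewrite /derivableC /derivC.
have E1 := funext (fun t => Re_comb c (y1 t) (y2 t)).
have E2 := funext (fun t => Im_comb c (y1 t) (y2 t)).
rewrite E1 E2.
split; first by split; apply: ex_derive.
rewrite !(derive1E (fun t => _ - _ + _)).
rewrite (@derive_val _ _ _ _ _ _ _ h1) (@derive_val _ _ _ _ _ _ _ h2).
by apply/eqP; rewrite eq_complex Re_comb Im_comb /= !eqxx.
Qed.

Lemma derivC_eq l r y1 y2 x : (forall t, t \in `]l, r[ -> y1 t = y2 t) -> x \in `]l, r[ ->
  (derivableC y1 x -> derivableC y2 x) /\ derivC y1 x = derivC y2 x.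
Proof.
move=> e xI.
have nr : \forall t \near x, y1 t = y2 t.
  by apply: filterS (near_in_itvoo xI) => t tI; exact: e.
have nre : {near x, (fun t => complex.Re (y1 t)) =1 (fun t => complex.Re (y2 t))}.
  by apply: filterS nr => t ->.
have nim : {near x, (fun t => complex.Im (y1 t)) =1 (fun t => complex.Im (y2 t))}.
  by apply: filterS nr => t ->.
split.
  by move=> [dr di]; split; [exact: near_eq_derivable nre dr|exact: near_eq_derivable nim di].
by rewrite /derivC !derive1E (near_eq_derive _ nre) (near_eq_derive _ nim).
Qed.

Lemma loc_AC_eq l r y1 y2 dy : (forall t, t \in `]l, r[ -> y1 t = y2 t) ->
  loc_AC l r y1 dy -> loc_AC l r y2 dy.
Proof.
move=> e ac x t lx xt tr; have [i <-] := ac x t lx xt tr; split => //.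
by rewrite !e// in_itv/= ?lx ?tr ?(le_lt_trans xt)// (lt_le_trans lx).
Qed.

Lemma loc_AC_comb l r c y1 y2 dy1 dy2 : loc_AC l r y1 dy1 -> loc_AC l r y2 dy2 ->
  loc_AC l r (fun t => c * y1 t + y2 t) (fun t => c * dy1 t + dy2 t).
Proof.
move=> ac1 ac2 x t lx xt tr.
have [[ir1 ii1] e1] := ac1 x t lx xt tr.
have [[ir2 ii2] e2] := ac2 x t lx xt tr.
have mD : (R.-ocitv.-measurable).-sigma.-measurable (`[x, t]%classic : set R) by [].
have [i1 E1] := integrable_comb (complex.Re c) (complex.Im c) mD ir1 ii1 ir2.
have [i2 E2] := integrable_comb (complex.Re c) (- complex.Im c) mD ii1 ir1 ii2.
split.
  rewrite /integrableC; split.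
    by apply: eq_integrable i1 => // s _; rewrite /= Re_comb.
  by apply: eq_integrable i2 => // s _; rewrite /= Im_comb.
rewrite (_ : _ - _ = c * (y1 t - y1 x) + (y2 t - y2 x)); last by ring.
rewrite e1 e2; apply/eqP; rewrite eq_complex Re_comb Im_comb /= -E1 -E2.
apply/andP; split; apply/eqP; apply: eq_Rintegral => s _.
  by rewrite Re_comb.
by rewrite Im_comb.
Qed.

Lemma is_ell_eq q l r y1 y2 w1 w2 : (forall t, t \in `]l, r[ -> y1 t = y2 t) ->
  ae_eq_on l r w1 w2 -> is_ell q l r y1 w1 -> is_ell q l r y2 w2.
Proof.
move=> ey ew [dy [ddy [ac ae]]]; split.
  by move=> x xI; case: (derivC_eq ey xI) => h _; apply: h; exact: dy.
exists ddy; split.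
  by apply: loc_AC_eq ac => t tI; case: (derivC_eq ey tI).
by apply: aeS (aeI ew ae) => x [h1 h2] xI; rewrite -h1// h2// ey.
Qed.

Lemma ae_eq_on_refl l r w1 w2 : (forall t, t \in `]l, r[ -> w1 t = w2 t) ->
  ae_eq_on l r w1 w2.
Proof. exact: aeT. Qed.

Lemma is_ell_comb q l r c y1 y2 w1 w2 : is_ell q l r y1 w1 -> is_ell q l r y2 w2 ->
  is_ell q l r (fun t => c * y1 t + y2 t) (fun t => c * w1 t + w2 t).
Proof.
move=> [dy1 [ddy1 [ac1 ae1]]] [dy2 [ddy2 [ac2 ae2]]]; split.
  by move=> x xI; case: (derivC_comb c (dy1 x xI) (dy2 x xI)).
exists (fun t => c * ddy1 t + ddy2 t); split.
  apply: loc_AC_eq (loc_AC_comb c ac1 ac2) => x xI.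
  by case: (derivC_comb c (dy1 x xI) (dy2 x xI)).
by apply: aeS (aeI ae1 ae2) => x [h1 h2] xI; rewrite h1// h2//; ring.
Qed.

Lemma is_ell0 q l r : is_ell q l r (fun=> 0) (fun=> 0).
Proof.
have d0 (x : R) : is_derive x 1 (fun _ : R => 0 : R) 0 by exact: is_derive_cst.
split.
  by move=> x _; split; apply: ex_derive.
have -> : derivC (fun=> 0) = (fun=> 0 : R[i]).
  by apply/funext => x; rewrite /derivC !derive1E derive_val.
exists (fun=> 0); split; last by apply: aeT => x _; rewrite mulr0 addr0 oppr0.
move=> x t _ _ _; split.
  split; apply: eq_integrable (integrable0 _ _) => //.
by rewrite /integralC /= !Rintegral_cst//= mul0r subrr.
Qed.

Lemma is_ell_scale q l r c y w : is_ell q l r y w ->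
  is_ell q l r (fun t => c * y t) (fun t => c * w t).
Proof.
move=> h; apply: is_ell_eq (is_ell_comb c h (is_ell0 q l r)) => [t _|].
  by rewrite addr0.
by apply: ae_eq_on_refl => t _; rewrite addr0.
Qed.

Lemma is_ell_sub q l r y1 y2 w1 w2 : is_ell q l r y1 w1 -> is_ell q l r y2 w2 ->
  is_ell q l r (fun t => y1 t - y2 t) (fun t => w1 t - w2 t).
Proof.
move=> h1 h2; apply: is_ell_eq (is_ell_comb (-1) h2 h1) => [t _|].
  by rewrite mulN1r addrC.
by apply: ae_eq_on_refl => t _; rewrite mulN1r addrC.
Qed.

Lemma is_ell_subsol q l r y w (k : R) (g : R -> R) :
  (forall x, x \in `]l, r[ -> n1 (w x) <= k * n1 (y x) + g x) ->
  is_ell q l r y w -> subsol l r (fun x => n1 (q x) + k) g y.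
Proof.
move=> hw [dy [ddy [ac ae]]]; split=> //; exists ddy => //.
apply: aeS ae => x h xI.
have -> : ddy x = q x * y x - w x by rewrite h//; ring.
have := n1D (q x * y x) (- w x); have := n1M (q x) (y x); have := hw _ xI.
by rewrite n1N; lra.
Qed.

End SturmLiouville.

(** * Solutions up to the endpoints and their dependence on the parameter *)

Section Solutions.
Context {R : realType}.
Notation mu := (@lebesgue_measure R).
Implicit Types (l r : R) (y w q : R -> R[i]) (c z : R[i]).

Lemma integrable_coef l r q (k : R) : L2 l r q ->
  mu.-integrable `]l, r[ (EFin \o (fun x => n1 (q x) + k)).
Proof.
move=> /L2_integrable iq.
have mD : (R.-ocitv.-measurable).-sigma.-measurable (`]l, r[%classic : set R) by [].
exact: (integrableD mD iq (integrable_cst_itv l r k)).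
Qed.

Lemma ae_itv_exists l r (A : R -> Prop) : l < r -> {ae mu, forall x : R, A x} ->
  exists2 x, x \in `]l, r[ & A x.
Proof.
move=> lr [N [mN N0 NA]].
have [//|h] := pselect (exists2 x, x \in `]l, r[ & A x).
have sub : (`]l, r[ `<=` N)%classic.
  by move=> x xI; apply: NA => /= Ax; apply: h; exists x.
have : (mu `]l, r[ <= mu N)%E by apply: le_measure => //; rewrite inE.
rewrite [X in (_ <= X)%E -> _]N0 [X in (X <= _)%E -> _](lebesgue_measure_itv `]l, r[)/=.
by rewrite lte_fin lr -EFinB lee_fin leNgt subr_gt0 lr.
Qed.

(** A continuous function that vanishes almost everywhere vanishes. This separates the
    basis solutions from 0 in the Hilbert space: their Cauchy data are not both 0. *)
Lemma is_ell_ae0 q l r y w : is_ell q l r y w -> ae_eq_on l r y (fun=> 0) ->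
  forall x, x \in `]l, r[ -> y x = 0 /\ derivC y x = 0.
Proof.
move=> [dy _] y0.
have y00 x : x \in `]l, r[ -> y x = 0.
  move=> xI; apply: n1_eq0; apply/eqP; rewrite eq_le n1_ge0 andbT leNgt.
  apply/negP => p; have /cvgC_n1/(_ _ p) h := derivableC_cvg (dy _ xI).
  have /nbhs_ballP[e /= e0 he] : \forall t \near x, n1 (y x - y t) < n1 (y x) /\ t \in `]l, r[.
    near=> t; split; near: t => //; exact: near_in_itvoo.
  have [|t] := @ae_itv_exists (x - e) (x + e) _ _ y0; first by lra.
  rewrite in_itv/= => /andP[a b] yt.
  have /he[] : ball x e t by rewrite /ball/= ltr_norml; apply/andP; split; lra.
  by move=> + tI; rewrite yt// subr0 ltxx.
move=> x xI; split; first exact: y00.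
have [_ ->] := derivC_eq (y2 := fun=> 0) y00 xI.
by rewrite /derivC /= !derive1_cst.
Unshelve. all: by end_near.
Qed.

Lemma is_ell_ends q l r y w : l < r -> L2 l r q -> L2 l r w -> is_ell q l r y w ->
  [/\ (exists2 B, 0 <= B & forall x, x \in `]l, r[ -> energy y x <= B),
     (exists a, cvgC (r^'-) y a), (exists a, cvgC (r^'-) (derivC y) a),
     (exists a, cvgC (l^'+) y a) & (exists a, cvgC (l^'+) (derivC y) a)].
Proof.
move=> lr hq /L2_integrable iw ell.
apply: (subsol_cvg lr (integrable_coef 0 hq) iw).
by apply: is_ell_subsol ell => x _; rewrite mul0r add0r.
Qed.

Section Eigen.
Variables (q : R -> R[i]) (l r : R).
Hypotheses (lr : l < r) (hq : L2 l r q).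

Lemma eigen_subsol z y : is_ell q l r y (fun x => z * y x) ->
  subsol l r (fun x => n1 (q x) + n1 z) (fun=> 0) y.
Proof. by apply: is_ell_subsol => x _; rewrite addr0 n1M. Qed.

Lemma eigen_ends z y : is_ell q l r y (fun x => z * y x) ->
  [/\ (exists2 B, 0 <= B & forall x, x \in `]l, r[ -> energy y x <= B),
     (exists a, cvgC (r^'-) y a), (exists a, cvgC (r^'-) (derivC y) a),
     (exists a, cvgC (l^'+) y a) & (exists a, cvgC (l^'+) (derivC y) a)].
Proof.
move=> /eigen_subsol; apply: subsol_cvg => //; first exact: integrable_coef.
exact: integrable_cst_itv.
Qed.

Lemma eigen_L2 z y : is_ell q l r y (fun x => z * y x) ->
  [/\ L2 l r y, L2 l r (derivC y) & L2 l r (fun x => z * y x)].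
Proof.
move=> ell; have [[B B0 EB] _ _ _ _] := eigen_ends ell.
have ct x := subsol_cvg_pt (x := x) (eigen_subsol ell).
have L2y : L2 l r y.
  apply: (L2_bounded (B := B)).
  - by move=> x /ct[/cvgC_ReIm[]].
  - by move=> x /ct[/cvgC_ReIm[]].
  - by move=> x /EB; apply: le_trans; rewrite lerDl n1_ge0.
split=> //; last exact: L2_scale.
apply: (L2_bounded (B := B)).
- by move=> x /ct[_ /cvgC_ReIm[]].
- by move=> x /ct[_ /cvgC_ReIm[]].
- by move=> x /EB; apply: le_trans; rewrite lerDr n1_ge0.
Qed.

Lemma cvgC_cvg_n1 {T} (F : set_system T) {FF : Filter F} (f : T -> R[i]) a :
  cvgC F f a -> n1 (f t) @[t --> F] --> n1 a.
Proof.
move=> /cvgC_n1 h; apply/cvgrPdist_lt => e /h; apply: filterS => t.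
by apply: le_lt_trans; exact: n1_dist.
Qed.

(** Continuity in the spectral parameter. The difference of the solutions for [z] and [lam]
    has vanishing Cauchy data along [F] and is a subsolution with forcing n1 (z - lam) B,
    where [B] bounds the energy of the solution for [lam]. The filters [F] and [G] stand for
    the two endpoints, in either order. *)
Lemma eigen_cvg (F G : set_system R) {FF : ProperFilter F} {GG : ProperFilter G}
  (u : R[i] -> R -> R[i]) e0 e1 (a b : R[i] -> R[i]) lam :
  F `]l, r[%classic -> G `]l, r[%classic ->
  (forall z, is_ell q l r (u z) (fun x => z * u z x)) ->
  (forall z, cvgC F (u z) e0) -> (forall z, cvgC F (derivC (u z)) e1) ->
  (forall z, cvgC G (u z) (a z)) -> (forall z, cvgC G (derivC (u z)) (b z)) ->
  cvgC (nbhs (lam : R[i]^o)) a (a lam) /\ cvgC (nbhs (lam : R[i]^o)) b (b lam).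
Proof.
move=> FI GI ell u0 u1 ua ub.
have [[B B0 EB] _ _ _ _] := eigen_ends (ell lam).
(* For n1 (z - lam) < 1 the coefficient n1 q + n1 z is at most n1 q + n1 lam + 1. *)
have [C C0 hC] := subsol_bound lr (integrable_coef (n1 lam + 1) hq).
pose K := C * (2 * B * (r - l)).
have main z : n1 (z - lam) < 1 ->
    n1 (a z - a lam) <= K * n1 (z - lam) /\ n1 (b z - b lam) <= K * n1 (z - lam).
  move=> z1; pose D x := u z x - u lam x.
  have ellD := is_ell_sub (ell z) (ell lam).
  have sD : subsol l r (fun x => n1 (q x) + (n1 lam + 1)) (fun=> n1 (z - lam) * B) D.
    apply: is_ell_subsol ellD => x xI.
    rewrite (_ : _ - _ = z * D x + (z - lam) * u lam x); last by rewrite /D; ring.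
    apply: le_trans (n1D _ _) _; apply: lerD.
      apply: le_trans (n1M _ _) _; rewrite ler_wpM2r ?n1_ge0//.
      by have := n1D (z - lam) lam; rewrite subrK; lra.
    apply: le_trans (n1M _ _) _; rewrite ler_wpM2l ?n1_ge0//.
    by apply: le_trans (EB _ xI); rewrite lerDl n1_ge0.
  have dD x : x \in `]l, r[ -> derivC D x = derivC (u z) x - derivC (u lam) x.
    move=> xI; have [dz _] := ell z; have [dl _] := ell lam.
    have [_ E] := derivC_comb (-1) (dl x xI) (dz x xI).
    have [_ ->] := derivC_eq (y2 := fun t => -1 * u lam t + u z t)
      (fun t _ => etrans (addrC _ _) (congr1 (+%R^~ _) (esym (mulN1r _)))) xI.
    by rewrite E mulN1r addrC.
  have bnd x : x \in `]l, r[ -> energy D x <= K * n1 (z - lam).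
    move=> xI; have h := hC _ _ (integrable_cst_itv l r _) sD x.
    have E0 : C * (energy D t + 2 * \int[mu]_(s in `]l, r[) `|n1 (z - lam) * B|) @[t --> F]
       --> C * (0 + 2 * \int[mu]_(s in `]l, r[) `|n1 (z - lam) * B|).
      apply: cvgM; first exact: cvg_cst.
      apply: cvgD; last exact: cvg_cst.
      have -> : (0 : R) = n1 (e0 - e0) + n1 (e1 - e1).
        by rewrite !subrr /n1 /= normr0 !addr0.
      apply: cvgD.
        by apply: cvgC_cvg_n1; apply: cvgCB.
      apply: cvgC_cvg_n1; apply: cvgC_near (cvgCB (u1 z) (u1 lam)).
      by apply: filterS FI => t tI; rewrite dD.
    have -> : K * n1 (z - lam) = C * (0 + 2 * \int[mu]_(s in `]l, r[) `|n1 (z - lam) * B|).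
      rewrite Rintegral_cst//= (lebesgue_measure_itv `]l, r[)/= lte_fin lr -EFinB /=.
      by rewrite ger0_norm ?mulr_ge0 ?n1_ge0// /K; ring.
    apply: (cvgr_to_ge E0).
    by apply: filterS FI => t tI; exact: h.
  have lim_le (f : R -> R[i]) m : cvgC G f m ->
      (forall x, x \in `]l, r[ -> n1 (f x) <= K * n1 (z - lam)) ->
      n1 m <= K * n1 (z - lam).
    move=> /cvgC_cvg_n1 fm h; apply: (cvgr_to_le fm).
    by apply: filterS GI => t tI; exact: h.
  split.
    apply: lim_le (cvgCB (ua z) (ua lam)) _ => x xI.
    by apply: le_trans (bnd _ xI); rewrite lerDl n1_ge0.
  apply: lim_le (cvgCB (ub z) (ub lam)) _ => x xI.
  by rewrite -dD//; apply: le_trans (bnd _ xI); rewrite lerDr n1_ge0.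
have K0 : 0 <= K by rewrite /K !mulr_ge0// subr_ge0 ltW.
have near_lam e : 0 < e -> \forall z \near (lam : R[i]^o), n1 (z - lam) < e.
  move=> e0'; have /cvgC_n1/(_ _ e0') : cvgC (nbhs (lam : R[i]^o)) id lam
    by rewrite cvgCE; exact: cvg_id.
  by apply: filterS => z; rewrite -n1N opprB.
have fin e : 0 < e -> \forall z \near (lam : R[i]^o), K * n1 (z - lam) < e /\ n1 (z - lam) < 1.
  move=> e0'; have K1 : 0 < K + 1 by lra.
  have := near_lam _ (divr_gt0 e0' K1); have := near_lam _ ltr01.
  apply: filterS2 => z h1; rewrite ltr_pdivlMr// => h2; split=> //.
  by have := n1_ge0 (z - lam); lra.
split; apply/cvgC_n1 => e /fin; apply: filterS => z [h1 /main[h2 h3]].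
  by rewrite -n1N opprB; apply: le_lt_trans h1.
by rewrite -n1N opprB; apply: le_lt_trans h1.
Qed.

End Eigen.
End Solutions.

(** * Reciprocals of Nevanlinna functions and elimination *)

Section Ports.
Context {R : realType}.
Implicit Types (z w : R[i]) (n m : nat).

Lemma Im_pole (a d : R) w : complex.Im ((a ^+ 2)%:C / (w - d%:C)) =
  - complex.Im w * (a ^+ 2 / ((complex.Re w - d) ^+ 2 + complex.Im w ^+ 2)).
Proof. by case: w => x y /=; rewrite oppr0 addr0 mul0r addr0; ring. Qed.

(** With a positive linear coefficient the imaginary part of [nevan] has the sign of that of
    [w] off the real axis, so the identity between [nevan] and its reciprocal expansion holds
    there without exception. Approaching a real point vertically gives the two facts needed:
    away from its own poles [d], [nevan] vanishes at the points of [de] and nowhere else. *)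
Section Nevanlinna.
Variables (n m : nat) (k e t : R) (a d : 'cV[R]_n) (al de : 'cV[R]_m).

(** The common form of -mu and nu. *)
Definition nevan w : R[i] :=
  w * k%:C + e%:C - \sum_(i < n) (a i 0 ^+ 2)%:C / (w - (d i 0)%:C).
Definition inv_nevan w : R[i] :=
  t%:C + \sum_(j < m) (al j 0 ^+ 2)%:C / (w - (de j 0)%:C).

Lemma nevan_nonreal w : 0 < k -> complex.Im w != 0 -> nevan w != 0.
Proof.
move=> k0 w0; apply/eqP => /(congr1 (@complex.Im R)).
rewrite raddfB raddf_sum /= raddfD /=.
under eq_bigr do rewrite Im_pole.
rewrite -mulr_sumr.
have -> : complex.Im (w * k%:C) = complex.Im w * k by case: w {w0} => x y /=; ring.
set S := \sum_(i < n) _; have S0 : 0 <= S.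
  by apply: sumr_ge0 => i _; rewrite divr_ge0 ?addr_ge0 ?sqr_ge0.
move=> E; have : complex.Im w * (k + S) = 0 by rewrite -[RHS]E; ring.
by move=> /eqP; rewrite mulf_eq0 (negbTE w0) gt_eqF//; lra.
Qed.

Hypothesis k0 : 0 < k.
Hypothesis al0 : forall j, 0 < al j 0.
Hypothesis de_incr : increasing de.
Hypothesis invE : forall w, off d w -> nevan w != 0 -> (nevan w)^-1 = inv_nevan w.

Lemma increasing_inj i j : de i 0 = de j 0 -> i = j.
Proof.
by case: (ltngtP i j) => [/de_incr + E|/de_incr + E|/val_inj//]; rewrite E ltxx.
Qed.

Definition vert z (s : R) : R[i] := z + s *i.

Lemma cvgC_vert z : cvgC 0^'+ (vert z) z.
Proof.
rewrite -[z in cvgC _ _ z]addr0; apply: cvgCD; first exact: cvgC_cst.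
apply/cvgC_ReIm => /=; split; first exact: cvg_cst.
by apply: cvg_within_filter; exact: cvg_id.
Qed.

Lemma cvgC_nevan (F : set_system R) {FF : Filter F} (f : R -> R[i]) z :
  off d z -> cvgC F f z -> cvgC F (fun s => nevan (f s)) (nevan z).
Proof.
move=> oz fz; rewrite /nevan; apply: cvgCB.
  apply: cvgCD; last exact: cvgC_cst.
  by apply: cvgCM; [exact: fz|exact: cvgC_cst].
apply: cvgC_sum => i _; apply: cvgCM; first exact: cvgC_cst.
apply: cvgCV; first by rewrite subr_eq0; exact: oz.
by apply: cvgCB; [exact: fz|exact: cvgC_cst].
Qed.

Lemma nevan_vert z : off d z -> complex.Im z = 0 ->
  \forall s \near (0 : R)^'+, nevan (vert z s) * inv_nevan (vert z s) = 1.
Proof.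
move=> oz z0; near=> s.
have s0 : 0 < s by near: s; exact: nbhs_right_gt.
have I0 : complex.Im (vert z s) != 0.
  by case: z {oz} z0 => x y /= ->; rewrite add0r gt_eqF.
rewrite -invE; last by apply: nevan_nonreal.
  by rewrite divff// nevan_nonreal.
by move=> i; apply: contraNneq I0 => ->.
Unshelve. all: by end_near.
Qed.

Lemma nevan_neq0 z : off d z -> off de z -> nevan z != 0.
Proof.
move=> oz oz'; have [z0|] := eqVneq (complex.Im z) 0; last exact: nevan_nonreal.
have h1 : cvgC 0^'+ (fun s => nevan (vert z s)) (nevan z).
  exact: cvgC_nevan oz (cvgC_vert (z := z)).
have h2 : cvgC 0^'+ (fun s => inv_nevan (vert z s)) (inv_nevan z).
  rewrite /inv_nevan; apply: cvgCD; first exact: cvgC_cst.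
  apply: cvgC_sum => i _; apply: cvgCM; first exact: cvgC_cst.
  apply: cvgCV; first by rewrite subr_eq0; exact: oz'.
  by apply: cvgCB; [exact: cvgC_vert|exact: cvgC_cst].
have : nevan z * inv_nevan z = 1.
  apply: cvgC_uniq (cvgCM h1 h2) _.
  by apply: cvgC_near (cvgC_cst (l := 1)); apply: filterS (nevan_vert oz z0) => s ->.
by move=> h; apply/eqP => E; move/eqP: h; rewrite E mul0r eq_sym oner_eq0.
Qed.

(** Multiplying nevan * inv_nevan = 1 by w - de j removes the pole; in the limit the residue
    [al j ^+ 2] remains as a factor, which is not 0. *)
Lemma nevan_eq0 j : off d (de j 0)%:C -> nevan (de j 0)%:C = 0.
Proof.
set z := (de j 0)%:C => oz; have z0 : complex.Im z = 0 by [].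
have h1 : cvgC 0^'+ (fun s => nevan (vert z s)) (nevan z).
  exact: cvgC_nevan oz (cvgC_vert (z := z)).
pose rest w := (w - z) * t%:C + (al j 0 ^+ 2)%:C +
  (w - z) * \sum_(i < m | i != j) (al i 0 ^+ 2)%:C / (w - (de i 0)%:C).
have h2 : cvgC 0^'+ (fun s => rest (vert z s)) (rest z).
  have hz : cvgC 0^'+ (fun s => vert z s - z) (z - z).
    by apply: cvgCB; [exact: cvgC_vert|exact: cvgC_cst].
  rewrite /rest; apply: cvgCD; first apply: cvgCD; last 1 first.
  - apply: cvgCM; [exact: hz|]; apply: cvgC_sum => i ij; apply: cvgCM; first exact: cvgC_cst.
    apply: cvgCV; last by apply: cvgCB; [exact: cvgC_vert|exact: cvgC_cst].
    rewrite subr_eq0; apply: contra ij => /eqP/complexI E.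
    by apply/eqP/increasing_inj.
  - by apply: cvgCM; [exact: hz|exact: cvgC_cst].
  - exact: cvgC_cst.
have : nevan z * rest z = z - z.
  apply: cvgC_uniq (cvgCM h1 h2) _.
  apply: cvgC_near (cvgCB (cvgC_vert (z := z)) (cvgC_cst (l := z))).
  near=> s.
  have s0 : 0 < s by near: s; exact: nbhs_right_gt.
  have E : nevan (vert z s) * inv_nevan (vert z s) = 1.
    by near: s; exact: nevan_vert.
  have v0 : vert z s - z != 0.
    by rewrite /vert addrC addKr eq_complex /= negb_and (gt_eqF s0) orbT.
  rewrite /= -[LHS]mulr1 -E mulrCA; congr (_ * _).
  rewrite /rest /inv_nevan (bigD1 j)//= -/z; field.
  by rewrite v0.
rewrite subrr /rest subrr !mul0r add0r addr0 => /eqP; rewrite mulf_eq0 => /orP[/eqP//|].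
by rewrite eq_complex /= eqxx andbT expf_eq0 /= gt_eqF.
Unshelve. all: by end_near.
Qed.

End Nevanlinna.

(** A component coupled to the function through the weights [w] and the diagonal [d] can be
    solved for off [d]; what it contributes to the transfer condition is a partial fraction. *)
Section Elimination.
Variables (n : nat) (w d : 'cV[R]_n).

Lemma resolvE z (f : 'cV[R[i]]_n) i :
  ((z%:M - diagC d) *m f) i 0 = (z - (d i 0)%:C) * f i 0.
Proof.
by rewrite mulmxBl mul_scalar_mx mul_diag_mx !mxE mulrBl.
Qed.

Lemma resolv_inv z (v : 'cV[R[i]]_n) : off d z ->
  invmx (z%:M - diagC d) *m v = \col_i (v i 0 / (z - (d i 0)%:C)).
Proof.
move=> oz; have nz i : z - (d i 0)%:C != 0 by rewrite subr_eq0; exact: oz.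
have U : z%:M - diagC d \in unitmx.
  rewrite (_ : z%:M - diagC d = diag_mx (\row_i (z - (d i 0)%:C))).
    by rewrite unitmxE det_diag unitfE; apply/prodf_neq0 => i _; rewrite mxE.
  by apply/matrixP => i j; rewrite !mxE mulrnBl.
apply: (can_inj (mulKmx U)); rewrite mulKVmx//.
apply/colP => i; rewrite resolvE mxE mulrC divfK//.
Qed.

Lemma elim_port z (h f : 'cV[R[i]]_n) (t : R[i]) : off d z ->
  - t *: vecC w + (z%:M - diagC d) *m f = h ->
  dot f (vecC w) = dot h (invmx (z%:M - diagC d) *m vecC w) +
    t * \sum_(i < n) (w i 0 ^+ 2)%:C / (z - (d i 0)%:C).
Proof.
move=> oz E; rewrite resolv_inv// mulr_sumr -big_split /=.
apply: eq_bigr => i _; have nz : z - (d i 0)%:C != 0 by rewrite subr_eq0; exact: oz.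
have := congr1 (fun M : 'cV_n => M i 0) E; rewrite /= [X in X = _ -> _]mxE resolvE !mxE => <-.
rewrite rmorphXn /=; field.
by [].
Qed.

Hypothesis w0 : forall i, 0 < w i 0.

(** If [z] is an entry of [d] the equation forces t = 0, and the component along that entry
    is free to match any value of [c]. *)
Lemma port_exists z (c t : R[i]) :
  (off d z -> c = t * \sum_(i < n) (w i 0 ^+ 2)%:C / (z - (d i 0)%:C)) ->
  (~ off d z -> t = 0) ->
  exists f : 'cV[R[i]]_n,
    - t *: vecC w + (z%:M - diagC d) *m f = 0 /\ dot f (vecC w) = c.
Proof.
move=> h1 h2; have [oz|oz] := pselect (off d z).
  exists (\col_i (t * (w i 0)%:C / (z - (d i 0)%:C))).
  have nz i : z - (d i 0)%:C != 0 by rewrite subr_eq0; exact: oz.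
  split.
    by apply/colP => i; rewrite mxE resolvE !mxE; field; exact: nz.
  rewrite h1// mulr_sumr; apply: eq_bigr => i _; rewrite !mxE rmorphXn /=.
  by field; exact: nz.
have [j /eqP zj] : exists j, z == (d j 0)%:C.
  by apply: contrapT => h; apply: oz => j; apply/negP => zj; apply: h; exists j.
exists (\col_i (if i == j then c / (w j 0)%:C else 0)); rewrite (h2 oz); split.
  apply/colP => i; rewrite mxE resolvE !mxE oppr0 mul0r add0r.
  by case: eqP => [->|]; rewrite ?mulr0// zj subrr mul0r.
rewrite /dot (bigD1 j)//= big1 ?addr0 => [|i /negbTE ij]; last by rewrite !mxE ij mul0r.
by rewrite !mxE eqxx divfK// eq_complex /= eqxx andbT gt_eqF.
Qed.

End Elimination.
End Ports.

(** * The linear system at the interface *)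

Section MatrixLimits.
Context {R : realType} {T : Type} (F : set_system T) {FF : Filter F}.

Definition cvgMx m n (M : T -> 'M[R[i]]_(m, n)) (M0 : 'M[R[i]]_(m, n)) : Prop :=
  forall i j, cvgC F (fun t => M t i j) (M0 i j).

Lemma cvgMx_cst m n (M0 : 'M[R[i]]_(m, n)) : cvgMx (fun=> M0) M0.
Proof. by move=> i j; exact: cvgC_cst. Qed.

Lemma cvgMx_B m n (A B : T -> 'M[R[i]]_(m, n)) A0 B0 : cvgMx A A0 -> cvgMx B B0 ->
  cvgMx (fun t => A t - B t) (A0 - B0).
Proof.
move=> hA hB i j; rewrite !mxE; under [X in cvgC _ X]eq_fun do rewrite !mxE.
by apply: cvgCB; [exact: hA|exact: hB].
Qed.

Lemma cvgMx_mul m n p (A : T -> 'M[R[i]]_(m, n)) (B : T -> 'M[R[i]]_(n, p)) A0 B0 :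
  cvgMx A A0 -> cvgMx B B0 -> cvgMx (fun t => A t *m B t) (A0 *m B0).
Proof.
move=> hA hB i j; rewrite mxE; under [X in cvgC _ X]eq_fun do rewrite mxE.
by apply: cvgC_sum => k _; apply: cvgCM; [exact: hA|exact: hB].
Qed.

Lemma cvgMx_col m1 m2 n (A : T -> 'M[R[i]]_(m1, n)) (B : T -> 'M[R[i]]_(m2, n)) A0 B0 :
  cvgMx A A0 -> cvgMx B B0 -> cvgMx (fun t => col_mx (A t) (B t)) (col_mx A0 B0).
Proof.
move=> hA hB i j; rewrite mxE; under [X in cvgC _ X]eq_fun do rewrite mxE.
by case: (fintype.split i) => k; [exact: hA|exact: hB].
Qed.

Lemma cvgMx_row m n1 n2 (A : T -> 'M[R[i]]_(m, n1)) (B : T -> 'M[R[i]]_(m, n2)) A0 B0 :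
  cvgMx A A0 -> cvgMx B B0 -> cvgMx (fun t => row_mx (A t) (B t)) (row_mx A0 B0).
Proof.
move=> hA hB i j; rewrite mxE; under [X in cvgC _ X]eq_fun do rewrite mxE.
by case: (fintype.split j) => k; [exact: hA|exact: hB].
Qed.

Lemma cvgMx_block m1 m2 n1 n2 (A : T -> 'M[R[i]]_(m1, n1)) (B : T -> 'M[R[i]]_(m1, n2))
    (C : T -> 'M[R[i]]_(m2, n1)) (D : T -> 'M[R[i]]_(m2, n2)) A0 B0 C0 D0 :
  cvgMx A A0 -> cvgMx B B0 -> cvgMx C C0 -> cvgMx D D0 ->
  cvgMx (fun t => block_mx (A t) (B t) (C t) (D t)) (block_mx A0 B0 C0 D0).
Proof. by move=> hA hB hC hD; apply: cvgMx_col; apply: cvgMx_row. Qed.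

Lemma cvgMx_det n (M : T -> 'M[R[i]]_n) M0 : cvgMx M M0 ->
  cvgC F (fun t => \det (M t)) (\det M0).
Proof.
move=> hM; rewrite /determinant; apply: cvgC_sum => s _; apply: cvgCM.
  exact: cvgC_cst.
by apply: cvgC_prod => i _; exact: hM.
Qed.

Lemma cvgMx_adj n (M : T -> 'M[R[i]]_n) M0 : cvgMx M M0 ->
  cvgMx (fun t => \adj (M t)) (\adj M0).
Proof.
move=> hM i j; rewrite mxE; under [X in cvgC _ X]eq_fun do rewrite mxE.
rewrite /cofactor; apply: cvgCM; first exact: cvgC_cst.
apply: cvgMx_det => a b; rewrite !mxE; under [X in cvgC _ X]eq_fun do rewrite !mxE.
exact: hM.
Qed.

Lemma cvgC_neq0 (f : T -> R[i]) l : cvgC F f l -> l != 0 -> \forall t \near F, f t != 0.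
Proof.
move=> /cvgC_n1 h l0; have n0 : 0 < n1 l.
  by rewrite lt_neqAle n1_ge0 andbT eq_sym; apply: contraNneq l0 => /n1_eq0 ->.
by apply: filterS (h _ n0) => t; apply: contraTneq => ->; rewrite subr0 ltxx.
Qed.

Lemma cvgMx_unit n (M : T -> 'M[R[i]]_n) M0 : cvgMx M M0 -> M0 \in unitmx ->
  \forall t \near F, M t \in unitmx.
Proof.
move=> /cvgMx_det h; rewrite unitmxE unitfE => /(cvgC_neq0 h).
by apply: filterS => t; rewrite unitmxE unitfE.
Qed.

(** By Cramer's rule. *)
Lemma cvgMx_inv n (M : T -> 'M[R[i]]_n) M0 : cvgMx M M0 -> M0 \in unitmx ->
  cvgMx (fun t => invmx (M t)) (invmx M0).
Proof.
move=> hM U i j; have nU := cvgMx_unit hM U.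
rewrite [invmx M0]/invmx U mxE.
apply: (cvgC_near (f := fun t => (\det (M t))^-1 * (\adj (M t)) i j)).
  by apply: filterS nU => t Ut; rewrite /invmx Ut [RHS]mxE.
apply: cvgCM; last exact: cvgMx_adj.
apply: cvgCV; last exact: cvgMx_det.
by move: U; rewrite unitmxE unitfE.
Qed.

End MatrixLimits.

Lemma inj_unitmx (K : fieldType) n (M : 'M[K]_n) :
  (forall X : 'cV_n, M *m X = 0 -> X = 0) -> M \in unitmx.
Proof.
move=> h; rewrite -unitmx_tr -row_free_unit; apply: inj_row_free => v hv.
by apply: trmx_inj; rewrite trmx0; apply: h; rewrite -[M]trmxK -trmx_mul hv trmx0.
Qed.

Section System.
Context {R : realType} (P : problem R) (hP : standing P).
Implicit Types (z s A B : R[i]).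

(** In a quadruple of boundary values, [s0] and [s0'] are those of the function and its
    derivative at 0-, [s1] and [s1'] those at 0+. *)
Definition btr1 s0 s0' s1 s1' : R[i] := if 0 < eta P then s1' - s0' else s1.
Definition btr2 s0 s0' s1 s1' : R[i] := if 0 < kappa P then s1 - s0 else s0'.
Definition bc1 s0 s0' s1 s1' : R[i] :=
  if 0 < eta P then - s1 + (sigma P)%:C * (s1' - s0') else (s1' - s0') - (xi P)%:C * s1.
Definition bc2 s0 s0' s1 s1' : R[i] :=
  if 0 < kappa P then s0' - (tau P)%:C * (s1 - s0)
  else - (s1 - s0) + (zeta P)%:C * s0'.

Lemma muE z : mu P z = - nevan (eta P) (- xi P) (bv P) (cv P) z.
Proof. by rewrite /mu /nevan rmorphN. Qed.

Lemma nuE z : nu P z = nevan (kappa P) (zeta P) (av P) (dv P) z.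
Proof. by []. Qed.

Lemma dotZr n k (x y : 'cV[R[i]]_n) : dot x (k *: y) = k * dot x y.
Proof. by rewrite /dot mulr_sumr; apply: eq_bigr => i _; rewrite mxE mulrCA. Qed.

Lemma eta_eq0 : ~~ (0 < eta P) -> eta P = 0.
Proof. by rewrite -leNgt => h; apply/eqP; rewrite eq_le h (eta_ge0 hP). Qed.

Lemma kappa_eq0 : ~~ (0 < kappa P) -> kappa P = 0.
Proof. by rewrite -leNgt => h; apply/eqP; rewrite eq_le h (kappa_ge0 hP). Qed.

Lemma nevan_mu : 0 < eta P -> forall w, off (cv P) w ->
  nevan (eta P) (- xi P) (bv P) (cv P) w != 0 ->
  (nevan (eta P) (- xi P) (bv P) (cv P) w)^-1 =
    inv_nevan (- sigma P) (betav P) (gammav P) w.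
Proof.
move=> e0 w ow w0; have [_ _ _ h] := mu_inv hP e0.
rewrite -[LHS]opprK -invrN -muE h//; last by rewrite muE oppr_eq0.
by rewrite /inv_nevan rmorphN /= opprB addrC.
Qed.

(** Off the poles a transfer condition with its component eliminated becomes a condition
    with the coefficient [mu] (here) or [nu] (below). If [eta] is positive the elimination
    produces 1 / mu, and the equation is multiplied by mu. *)
Lemma transfer1_elim z s0 s0' s1 s1' (f h : 'cV[R[i]]_(Nstar P)) :
  off (cv P) z -> off (dg1 P) z ->
  bc1 s0 s0' s1 s1' - dot f (vecC (wt1 P)) = 0 ->
  - btr1 s0 s0' s1 s1' *: vecC (wt1 P) + (z%:M - diagC (dg1 P)) *m f = h ->
  (s1' - s0') - mu P z * s1 = dot h (pvec P z).
Proof.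
move=> oc od + E; rewrite (elim_port od E) /pvec dotZr => /eqP; rewrite subr_eq0 => /eqP.
set D := dot h _ => bc; clearbody D; move: bc {E h f}.
have nz0 : 0 < eta P -> off (gammav P) z -> nevan (eta P) (- xi P) (bv P) (cv P) z != 0.
  by move=> e0; exact: (nevan_neq0 e0 (nevan_mu e0) oc).
move: nz0; have := nevan_mu; have := eta_eq0; have := muE z; move: od.
rewrite /bc1 /btr1 /wt1 /dg1 /Nstar /sel; case: (0 < eta P) => od Emu e0 nm nz0 bc.
  have nz := nz0 isT od.
  have := nm isT z oc nz; rewrite /inv_nevan rmorphN /= => E.
  have E' : 1 = - mu P z * (- (sigma P)%:C + \sum_(j < N1 P)
              (betav P j 0 ^+ 2)%:C / (z - (gammav P j 0)%:C)).
    by rewrite -E Emu opprK divff//.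
  move: bc E'; set S := \sum_(j < _) _ => bc E'.
  have -> : D = - s1 + (sigma P)%:C * (s1' - s0') - (s1' - s0') * S by rewrite bc addrK.
  by rewrite -[s1' - s0' in LHS]mul1r E'; ring.
rewrite mul1r Emu /nevan e0// mulr0 add0r rmorphN/=.
by move: bc; set S := \sum_(j < _) _ => bc; rewrite -[D](addrK (s1 * S)) -bc; ring.
Qed.

Lemma transfer2_elim z s0 s0' s1 s1' (f h : 'cV[R[i]]_(Mstar P)) :
  off (dv P) z -> off (dg2 P) z ->
  bc2 s0 s0' s1 s1' - dot f (vecC (wt2 P)) = 0 ->
  - btr2 s0 s0' s1 s1' *: vecC (wt2 P) + (z%:M - diagC (dg2 P)) *m f = h ->
  nu P z * s0' - (s1 - s0) = dot h (qvec P z).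
Proof.
move=> oc od + E; rewrite (elim_port od E) /qvec dotZr => /eqP; rewrite subr_eq0 => /eqP.
set D := dot h _ => bc; clearbody D; move: bc {E h f}.
have nz0 : 0 < kappa P -> off (deltav P) z ->
    nevan (kappa P) (zeta P) (av P) (dv P) z != 0.
  move=> k0; have [_ _ _ h] := nu_inv hP k0; exact: (nevan_neq0 k0 h oc).
have inv0 : 0 < kappa P -> off (deltav P) z -> (nu P z)^-1 =
    (tau P)%:C + \sum_(j < M1 P) (alphav P j 0 ^+ 2)%:C / (z - (deltav P j 0)%:C).
  move=> k0 od'; have [_ _ _ h] := nu_inv hP k0; apply: h oc _; exact: nz0.
move: nz0 inv0; have := kappa_eq0; have := nuE z; move: od.
rewrite /bc2 /btr2 /wt2 /dg2 /Mstar /sel; case: (0 < kappa P) => od Enu k0 nz0 inv0 bc.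
  have := inv0 isT od => E.
  have E' : 1 = nu P z * ((tau P)%:C + \sum_(j < M1 P)
              (alphav P j 0 ^+ 2)%:C / (z - (deltav P j 0)%:C)).
    by rewrite -E divff// Enu; exact: nz0.
  move: bc E'; set S := \sum_(j < _) _ => bc E'.
  have -> : D = s0' - (tau P)%:C * (s1 - s0) - (s1 - s0) * S by rewrite bc addrK.
  by rewrite -[s1 - s0 in LHS]mul1r E'; ring.
rewrite mul1r Enu /nevan k0// mulr0 add0r.
by move: bc; set S := \sum_(j < _) _ => bc; rewrite -[D](addrK (s0' * S)) -bc; ring.
Qed.

(** Conversely, a solution of the condition with coefficient [mu] extends to the component,
    also at the entries of [gammav], where [mu] vanishes. *)
Lemma transfer1_solvable z s0 s0' s1 s1' : off (cv P) z -> s1' - s0' = mu P z * s1 ->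
  exists f : 'cV[R[i]]_(Nstar P),
    bc1 s0 s0' s1 s1' - dot f (vecC (wt1 P)) = 0 /\
    - btr1 s0 s0' s1 s1' *: vecC (wt1 P) + (z%:M - diagC (dg1 P)) *m f = 0.
Proof.
move=> oc E.
suff [f [f1 f2]] : exists f : 'cV[R[i]]_(Nstar P),
    - btr1 s0 s0' s1 s1' *: vecC (wt1 P) + (z%:M - diagC (dg1 P)) *m f = 0 /\
    dot f (vecC (wt1 P)) = bc1 s0 s0' s1 s1'.
  by exists f; rewrite f2 subrr.
have nz0 : 0 < eta P -> off (gammav P) z -> nevan (eta P) (- xi P) (bv P) (cv P) z != 0.
  by move=> e0; exact: (nevan_neq0 e0 (nevan_mu e0) oc).
have pole0 : 0 < eta P -> ~ off (gammav P) z -> mu P z = 0.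
  move=> e0 og; have [_ ig b0 _] := mu_inv hP e0.
  have [j zj] : exists j, z = (gammav P j 0)%:C.
    by apply: contrapT => h; apply: og => j; apply/eqP => zj; apply: h; exists j.
  by rewrite muE zj (nevan_eq0 e0 b0 ig (nevan_mu e0)) ?oppr0// -zj.
have b0 := bv_gt0 hP; have be0 : 0 < eta P -> forall i, 0 < betav P i 0.
  by move=> e0; case: (mu_inv hP e0).
move: be0 pole0 nz0; have := nevan_mu; have := eta_eq0; have := muE z.
rewrite /bc1 /btr1 /wt1 /dg1 /Nstar /sel.
case: (0 < eta P) => Emu e0 nm be0 pole0 nz0; apply: port_exists.
- exact: be0.
- move=> og; have nz := nz0 isT og; have := nm isT z oc nz; rewrite /inv_nevan rmorphN /= => E1.
  have E' : 1 = - mu P z * (- (sigma P)%:C + \sum_(j < N1 P)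
              (betav P j 0 ^+ 2)%:C / (z - (gammav P j 0)%:C)).
    by rewrite -E1 Emu opprK divff.
  move: E'; set S := \sum_(j < _) _ => E'.
  have <- : (s1' - s0') * (- (sigma P)%:C + S) = - s1.
    by rewrite E -[RHS]mulr1 [in RHS]E'; ring.
  by ring.
- by move=> /(pole0 isT) m0; rewrite E m0 mul0r.
- exact: b0.
- move=> _; rewrite E Emu /nevan e0// mulr0 add0r rmorphN /=.
  by set S := \sum_(j < _) _; ring.
- by move=> h; case: h.
Qed.

Lemma transfer2_solvable z s0 s0' s1 s1' : off (dv P) z -> s1 - s0 = nu P z * s0' ->
  exists f : 'cV[R[i]]_(Mstar P),
    bc2 s0 s0' s1 s1' - dot f (vecC (wt2 P)) = 0 /\
    - btr2 s0 s0' s1 s1' *: vecC (wt2 P) + (z%:M - diagC (dg2 P)) *m f = 0.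
Proof.
move=> oc E.
suff [f [f1 f2]] : exists f : 'cV[R[i]]_(Mstar P),
    - btr2 s0 s0' s1 s1' *: vecC (wt2 P) + (z%:M - diagC (dg2 P)) *m f = 0 /\
    dot f (vecC (wt2 P)) = bc2 s0 s0' s1 s1'.
  by exists f; rewrite f2 subrr.
have nz0 : 0 < kappa P -> off (deltav P) z -> nu P z != 0.
  move=> k0; have [_ _ _ h] := nu_inv hP k0; exact: (nevan_neq0 k0 h oc).
have inv0 : 0 < kappa P -> off (deltav P) z -> (nu P z)^-1 =
    (tau P)%:C + \sum_(j < M1 P) (alphav P j 0 ^+ 2)%:C / (z - (deltav P j 0)%:C).
  move=> k0 od'; have [_ _ _ h] := nu_inv hP k0; apply: h oc _; exact: nz0.
have pole0 : 0 < kappa P -> ~ off (deltav P) z -> nu P z = 0.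
  move=> k0 og; have [_ ig a0 h] := nu_inv hP k0.
  have [j zj] : exists j, z = (deltav P j 0)%:C.
    by apply: contrapT => h'; apply: og => j; apply/eqP => zj; apply: h'; exists j.
  by rewrite nuE zj (nevan_eq0 k0 a0 ig h)// -zj.
have a0 := av_gt0 hP; have al0 : 0 < kappa P -> forall i, 0 < alphav P i 0.
  by move=> k0; case: (nu_inv hP k0).
move: al0 pole0 nz0 inv0; have := kappa_eq0; have := nuE z.
rewrite /bc2 /btr2 /wt2 /dg2 /Mstar /sel.
case: (0 < kappa P) => Enu k0 al0 pole0 nz0 inv0; apply: port_exists.
- exact: al0.
- move=> og; have nz := nz0 isT og; have E1 := inv0 isT og.
  have E' : 1 = nu P z * ((tau P)%:C + \sum_(j < M1 P)
              (alphav P j 0 ^+ 2)%:C / (z - (deltav P j 0)%:C)).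
    by rewrite -E1 divff.
  move: E'; set S := \sum_(j < _) _ => E'.
  have -> : s0' = (s1 - s0) * ((tau P)%:C + S).
    by rewrite E -[LHS]mulr1 [in LHS]E'; ring.
  by ring.
- by move=> /(pole0 isT) m0; rewrite E m0 mul0r.
- exact: a0.
- move=> _; rewrite E Enu /nevan k0// mulr0 add0r.
  by set S := \sum_(j < _) _; ring.
- by move=> h; case: h.
Qed.

Lemma bc1_lin A B s0 s0' s1 s1' : bc1 (A * s0) (A * s0') (B * s1) (B * s1') =
  A * bc1 s0 s0' 0 0 + B * bc1 0 0 s1 s1'.
Proof. by rewrite /bc1; case: ifP => _; ring. Qed.
Lemma bc2_lin A B s0 s0' s1 s1' : bc2 (A * s0) (A * s0') (B * s1) (B * s1') =
  A * bc2 s0 s0' 0 0 + B * bc2 0 0 s1 s1'.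
Proof. by rewrite /bc2; case: ifP => _; ring. Qed.
Lemma btr1_lin A B s0 s0' s1 s1' : btr1 (A * s0) (A * s0') (B * s1) (B * s1') =
  A * btr1 s0 s0' 0 0 + B * btr1 0 0 s1 s1'.
Proof. by rewrite /btr1; case: ifP => _; ring. Qed.
Lemma btr2_lin A B s0 s0' s1 s1' : btr2 (A * s0) (A * s0') (B * s1) (B * s1') =
  A * btr2 s0 s0' 0 0 + B * btr2 0 0 s1 s1'.
Proof. by rewrite /btr2; case: ifP => _; ring. Qed.

(** What remains of (z - L) F = H when F has the coefficients [A], [B] with respect to basis
    solutions whose boundary values are [x], [x'] at 0- and [y], [y'] at 0+. *)
Definition interface z (x x' y y' A B : R[i]) (f1 h1 : 'cV[R[i]]_(Nstar P))
    (f2 h2 : 'cV[R[i]]_(Mstar P)) : Prop :=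
  [/\ bc1 (A * x) (A * x') (B * y) (B * y') - dot f1 (vecC (wt1 P)) = 0,
      bc2 (A * x) (A * x') (B * y) (B * y') - dot f2 (vecC (wt2 P)) = 0,
      - btr1 (A * x) (A * x') (B * y) (B * y') *: vecC (wt1 P) +
        (z%:M - diagC (dg1 P)) *m f1 = h1 &
      - btr2 (A * x) (A * x') (B * y) (B * y') *: vecC (wt2 P) +
        (z%:M - diagC (dg2 P)) *m f2 = h2].

Definition row2 (x y : R[i]) : 'rV[R[i]]_2 := \row_j (if j == 0 then x else y).

Lemma row2_mul x y A B : row2 x y *m col2 A B = (A * x + B * y)%:M.
Proof.
apply/matrixP => i j; rewrite !mxE !big_ord_recl big_ord0 !mxE /= addr0.
by rewrite !ord1 eqxx mulr1n mulrC (mulrC y).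
Qed.

(** [interface] as a square system in A, B, f1, f2. Keeping the components instead of
    eliminating them has the advantage that the entries are continuous in [z], also at the
    poles of [mu] and [nu]. *)
Definition sysmx z (x x' y y' : R[i]) : 'M[R[i]]_((1 + 1) + (Nstar P + Mstar P)) :=
  block_mx
    (col_mx (row2 (bc1 x x' 0 0) (bc1 0 0 y y')) (row2 (bc2 x x' 0 0) (bc2 0 0 y y')))
    (block_mx (- (vecC (wt1 P))^T) 0 0 (- (vecC (wt2 P))^T))
    (col_mx (- (vecC (wt1 P) *m row2 (btr1 x x' 0 0) (btr1 0 0 y y')))
            (- (vecC (wt2 P) *m row2 (btr2 x x' 0 0) (btr2 0 0 y y'))))
    (block_mx (z%:M - diagC (dg1 P)) 0 0 (z%:M - diagC (dg2 P))).

Definition sysvec (A B : R[i]) (f1 : 'cV[R[i]]_(Nstar P)) (f2 : 'cV[R[i]]_(Mstar P)) :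
    'cV[R[i]]_((1 + 1) + (Nstar P + Mstar P)) := col_mx (col2 A B) (col_mx f1 f2).

Lemma dot_mx n (f w : 'cV[R[i]]_n) : - w^T *m f = (- dot f w)%:M.
Proof.
apply/matrixP => i j; rewrite !ord1 mulNmx !mxE eqxx mulr1n; congr (- _).
by apply: eq_bigr => k _; rewrite !mxE mulrC.
Qed.

Lemma scalar_mx11 (a : R[i]) : a%:M = 0 :> 'M[R[i]]_(1) -> a = 0.
Proof. by move=> /matrixP/(_ 0 0); rewrite !mxE. Qed.

Lemma sysmxP z x x' y y' A B f1 f2 h1 h2 :
  sysmx z x x' y y' *m sysvec A B f1 f2 = sysvec 0 0 h1 h2 <->
  interface z x x' y y' A B f1 h1 f2 h2.
Proof.
rewrite /sysmx /sysvec (@mul_block_col _ (1 + 1) _ (1 + 1)) !mul_col_mx !mul_row_col.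
rewrite !mul0mx !addr0 !add0r !row2_mul !dot_mx !mulNmx -!mulmxA !row2_mul.
rewrite !mul_mx_scalar !add_col_mx -!rmorphD/= /interface bc1_lin bc2_lin btr1_lin btr2_lin.
rewrite -!scaleNr.
have -> : col2 0 0 = col_mx 0 0 :> 'cV[R[i]]_(1 + 1).
  by rewrite col_mx0; apply/colP => i; rewrite !mxE; case: ifP.
split.
  move=> /eq_col_mx[/eq_col_mx[e1 e2] /eq_col_mx[e3 e4]]; split=> //.
    exact: scalar_mx11 e1.
  exact: scalar_mx11 e2.
by move=> [-> -> -> ->]; rewrite !raddf0.
Qed.

End System.

(** * One-sided limits and uniqueness of preimages *)

Section OneSided.
Context {R : realType}.
Implicit Types (l r : R) (y : R -> R[i]) (c : R[i]).

Lemma at_left_itv l r : l < r -> (r^'-) (`]l, r[%classic : set R).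
Proof.
move=> lr; near=> x; rewrite /= in_itv/=; apply/andP; split; near: x.
  exact: nbhs_left_gt.
exact: nbhs_left_lt.
Unshelve. all: by end_near.
Qed.

Lemma at_right_itv l r : l < r -> (l^'+) (`]l, r[%classic : set R).
Proof.
move=> lr; near=> x; rewrite /= in_itv/=; apply/andP; split; near: x.
  exact: nbhs_right_gt.
exact: nbhs_right_lt.
Unshelve. all: by end_near.
Qed.

Lemma cvgC_on (F : set_system R) {FF : Filter F} l r y1 y2 a :
  F (`]l, r[%classic : set R) -> (forall x, x \in `]l, r[ -> y1 x = y2 x) ->
  cvgC F y1 a -> cvgC F y2 a.
Proof. by move=> FI e; apply: cvgC_near; apply: filterS FI => x xI; exact: e. Qed.

Lemma derivC_sub y1 y2 x : derivableC y1 x -> derivableC y2 x ->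
  derivC (fun t => y1 t - y2 t) x = derivC y1 x - derivC y2 x.
Proof.
move=> d1 d2; have [_ E] := derivC_comb (-1) d2 d1.
rewrite -[RHS]addrC -mulN1r -E; congr (derivC _ x).
by apply/funext => t; rewrite mulN1r addrC.
Qed.

Lemma derivC_scale c y x : derivableC y x ->
  derivC (fun t => c * y t) x = c * derivC y x.
Proof.
move=> d; have d0 : derivableC (fun=> 0 : R[i]) x by split; exact: derivable_cst.
have [_ E] := derivC_comb c d d0.
have E0 : derivC (fun=> 0 : R[i]) x = 0 by rewrite /derivC /= !derive1_cst.
rewrite E0 addr0 in E; rewrite -E; congr (derivC _ x).
by apply/funext => t; rewrite addr0.
Qed.

End OneSided.

Section Operator.
Context {R : realType} (P : problem R) (hP : standing P).
Notation la := (- lenA P).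
Notation lb := (lenB P).
Implicit Types (y : R -> R[i]) (z A B : R[i]).

Lemma la0 : la < 0. Proof. by rewrite oppr_lt0 (lenA_gt0 hP). Qed.
Lemma lb0 : 0 < lb. Proof. exact: lenB_gt0 hP. Qed.

Lemma q_left : L2 la 0 (q P).
Proof. exact: L2_itvS (lexx _) (ltW lb0) (q_L2 hP). Qed.
Lemma q_right : L2 0 lb (q P).
Proof. exact: L2_itvS (ltW la0) (lexx _) (q_L2 hP). Qed.

Lemma transfer1E y f : transfer1 (P := P) y f =
  (bc1 P (limL y 0) (limL (derivC y) 0) (limR y 0) (limR (derivC y) 0)
   - dot f (vecC (wt1 P)) = 0).
Proof. by rewrite /transfer1 /bc1 /jump' /jump; case: ifP. Qed.

Lemma transfer2E y f : transfer2 (P := P) y f =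
  (bc2 P (limL y 0) (limL (derivC y) 0) (limR y 0) (limR (derivC y) 0)
   - dot f (vecC (wt2 P)) = 0).
Proof. by rewrite /transfer2 /bc2 /jump' /jump; case: ifP. Qed.

Lemma tr1E y : tr1 P y =
  btr1 P (limL y 0) (limL (derivC y) 0) (limR y 0) (limR (derivC y) 0).
Proof. by []. Qed.

Lemma tr2E y : tr2 P y =
  btr2 P (limL y 0) (limL (derivC y) 0) (limR y 0) (limR (derivC y) 0).
Proof. by []. Qed.

Lemma regular_lims l r y : l < r -> L2 l r (q P) -> regular_on P l r y ->
  [/\ (forall x, x \in `]l, r[ -> derivableC y x),
      cvgC (r^'-) y (limL y r) /\ cvgC (r^'-) (derivC y) (limL (derivC y) r) &
      cvgC (l^'+) y (limR y l) /\ cvgC (l^'+) (derivC y) (limR (derivC y) l)].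
Proof.
move=> lr hq [_ _ [w ell L2w]].
have [_ [a ha] [b hb] [c hc] [d hd]] := is_ell_ends lr hq L2w ell.
rewrite /limL /limR (cvgC_lim ha) (cvgC_lim hb) (cvgC_lim hc) (cvgC_lim hd).
by case: ell.
Qed.

Lemma regular_sub l r y1 y2 : regular_on P l r y1 -> regular_on P l r y2 ->
  regular_on P l r (fun x => y1 x - y2 x).
Proof.
move=> [a1 b1 [w1 e1 c1]] [a2 b2 [w2 e2 c2]]; split; first exact: L2_sub.
  apply: L2_eq (L2_sub b1 b2) => x xI.
  by case: e1 e2 => [d1 _] [d2 _]; rewrite derivC_sub//; [exact: d1|exact: d2].
by exists (fun x => w1 x - w2 x); [exact: is_ell_sub|exact: L2_sub].
Qed.

Lemma lims_sub l r y1 y2 : l < r -> L2 l r (q P) ->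
  regular_on P l r y1 -> regular_on P l r y2 ->
  [/\ limL (fun x => y1 x - y2 x) r = limL y1 r - limL y2 r,
      limL (derivC (fun x => y1 x - y2 x)) r = limL (derivC y1) r - limL (derivC y2) r,
      limR (fun x => y1 x - y2 x) l = limR y1 l - limR y2 l &
      limR (derivC (fun x => y1 x - y2 x)) l = limR (derivC y1) l - limR (derivC y2) l].
Proof.
move=> lr hq r1 r2.
have [d1 [a1 a1'] [b1 b1']] := regular_lims lr hq r1.
have [d2 [a2 a2'] [b2 b2']] := regular_lims lr hq r2.
have dE x : x \in `]l, r[ -> derivC y1 x - derivC y2 x = derivC (fun x => y1 x - y2 x) x.
  by move=> xI; rewrite derivC_sub//; [exact: d1|exact: d2].
split.
- exact: (cvgC_lim (cvgCB a1 a2)).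
- exact: (cvgC_lim (cvgC_on (at_left_itv lr) dE (cvgCB a1' a2'))).
- exact: (cvgC_lim (cvgCB b1 b2)).
- exact: (cvgC_lim (cvgC_on (at_right_itv lr) dE (cvgCB b1' b2'))).
Qed.

Lemma bc1_sub (a a' b b' c c' d d' : R[i]) :
  bc1 P (a - a') (b - b') (c - c') (d - d') = bc1 P a b c d - bc1 P a' b' c' d'.
Proof. by rewrite /bc1; case: ifP => _; ring. Qed.
Lemma bc2_sub (a a' b b' c c' d d' : R[i]) :
  bc2 P (a - a') (b - b') (c - c') (d - d') = bc2 P a b c d - bc2 P a' b' c' d'.
Proof. by rewrite /bc2; case: ifP => _; ring. Qed.
Lemma btr1_sub (a a' b b' c c' d d' : R[i]) :
  btr1 P (a - a') (b - b') (c - c') (d - d') = btr1 P a b c d - btr1 P a' b' c' d'.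
Proof. by rewrite /btr1; case: ifP => _; ring. Qed.
Lemma btr2_sub (a a' b b' c c' d d' : R[i]) :
  btr2 P (a - a') (b - b') (c - c') (d - d') = btr2 P a b c d - btr2 P a' b' c' d'.
Proof. by rewrite /btr2; case: ifP => _; ring. Qed.

Lemma dot_subl n (f g w : 'cV[R[i]]_n) : dot (f - g) w = dot f w - dot g w.
Proof. by rewrite /dot -sumrB; apply: eq_bigr => i _; rewrite !mxE mulrBl. Qed.

Lemma domL_sub (Y1 Y2 : vecH P) : domL Y1 -> domL Y2 -> domL (subH Y1 Y2).
Proof.
move=> [[i1 l1 r1] [a1 b1 t1 s1]] [[i2 l2 r2] [a2 b2 t2 s2]].
have [e1 e2 e3 e4] := lims_sub la0 q_left l1 l2.
have [e5 e6 e7 e8] := lims_sub lb0 q_right r1 r2.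
split; split.
- exact: L2_sub.
- exact: regular_sub.
- exact: regular_sub.
- by rewrite /= e3 e4 !mulrBl a1 a2.
- by rewrite /= e5 e6 !mulrBl b1 b2.
- move: t1 t2; rewrite !transfer1E /= e1 e2 e7 e8 bc1_sub dot_subl.
  by move=> /eqP; rewrite subr_eq0 => /eqP -> /eqP; rewrite subr_eq0 => /eqP ->; rewrite subrr.
- move: s1 s2; rewrite !transfer2E /= e1 e2 e7 e8 bc2_sub dot_subl.
  by move=> /eqP; rewrite subr_eq0 => /eqP -> /eqP; rewrite subr_eq0 => /eqP ->; rewrite subrr.
Qed.

Lemma tr_sub (Y1 Y2 : vecH P) : domL Y1 -> domL Y2 ->
  tr1 P (fn (subH Y1 Y2)) = tr1 P (fn Y1) - tr1 P (fn Y2) /\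
  tr2 P (fn (subH Y1 Y2)) = tr2 P (fn Y1) - tr2 P (fn Y2).
Proof.
move=> [[_ l1 r1] _] [[_ l2 r2] _].
have [e1 e2 _ _] := lims_sub la0 q_left l1 l2.
have [_ _ e7 e8] := lims_sub lb0 q_right r1 r2.
by rewrite !tr1E !tr2E /= e1 e2 e7 e8 btr1_sub btr2_sub.
Qed.

Lemma ae_eq_onS (l r l' r' : R) (f g : R -> R[i]) : l <= l' -> r' <= r ->
  ae_eq_on l r f g -> ae_eq_on l' r' f g.
Proof.
move=> ll rr; apply: aeS => x h; rewrite in_itv/= => /andP[a b]; apply: h.
by rewrite in_itv/= (le_lt_trans ll)//= (lt_le_trans b).
Qed.

(** The difference of two preimages is an eigenvector or 0. Its domain conditions follow from
    those of the preimages because all one-sided limits involved exist. *)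
Lemma resolvent_uniq z (H G1 G2 : vecH P) : ~ eigenvalueL P z ->
  resolventL z H G1 -> resolventL z H G2 -> eqH G1 G2.
Proof.
move=> hz [Z1 [i1 [Y1 [[gy1 d1 iz1] [el1 er1 z11 z12]]] [h1 h11 h12]]].
move=> [Z2 [i2 [Y2 [[gy2 d2 iz2] [el2 er2 z21 z22]]] [h2 h21 h22]]].
have [g1 g11 g12] := gy1; have [g2 g21 g22] := gy2.
pose D := subH G1 G2.
have zdiff : ae_eq_on la lb (fun x => fn Z1 x - fn Z2 x) (fun x => z * fn D x).
  apply: aeS (aeI h1 h2) => x [/= k1 k2] xI.
  by rewrite mulrBr; move: (k1 xI) (k2 xI) => <- /eqP; rewrite eq_sym subr_eq => /eqP ->; ring.
have gD : graphL D (scaleH z D).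
  split; first exact: L2_sub.
  exists (subH Y1 Y2); have [t1 t2] := tr_sub d1 d2; split; split.
  - split; rewrite /= ?g11 ?g21 ?g12 ?g22//.
    by apply: aeS (aeI g1 g2) => x [/= k1 k2] xI; rewrite k1// k2.
  - exact: domL_sub.
  - by apply: L2_scale; exact: L2_sub.
  - apply: is_ell_eq (is_ell_sub el1 el2) => //.
    exact: ae_eq_onS (lexx _) (ltW lb0) zdiff.
  - apply: is_ell_eq (is_ell_sub er1 er2) => //.
    exact: ae_eq_onS (ltW la0) (lexx _) zdiff.
  - rewrite t1 /= scalerBl mulmxBr scalerBr.
    have -> : z *: bd1 G1 = bd1 Z1 + bd1 H by rewrite -h11 /= addrC subrK.
    have -> : z *: bd1 G2 = bd1 Z2 + bd1 H by rewrite -h21 /= addrC subrK.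
    by rewrite z11 z21 -!g11 -!g21 opprD addrACA subrr addr0 opprD addrACA.
  - rewrite t2 /= scalerBl mulmxBr scalerBr.
    have -> : z *: bd2 G1 = bd2 Z1 + bd2 H by rewrite -h12 /= addrC subrK.
    have -> : z *: bd2 G2 = bd2 Z2 + bd2 H by rewrite -h22 /= addrC subrK.
    by rewrite z12 z22 -!g12 -!g22 opprD addrACA subrr addr0 opprD addrACA.
have [k0 k1 k2] : eqH D (zeroH P).
  by apply: contrapT => nD; apply: hz; exists D.
split.
- by apply: aeS k0 => x /= k xI; apply/eqP; rewrite -subr_eq0 k.
- by apply/eqP; rewrite -subr_eq0; apply/eqP.
- by apply/eqP; rewrite -subr_eq0; apply/eqP.
Qed.

End Operator.

(** * The resolvent on the finite-dimensional components *)

Section Resolvent.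
Context {R : realType} (P : problem R) (hP : standing P).
Notation la := (- lenA P).
Notation lb := (lenB P).
Variables (u v : R[i] -> R -> R[i]).
Hypothesis hu : forall z : R[i], is_uminus P z (u z).
Hypothesis hv : forall z : R[i], is_vplus P z (v z).
Implicit Types (z A B : R[i]).

Let U z := limL (u z) 0.
Let U' z := limL (derivC (u z)) 0.
Let V z := limR (v z) 0.
Let V' z := limR (derivC (v z)) 0.

Lemma u_ell z : is_ell (q P) la 0 (u z) (fun x => z * u z x).
Proof. by case: (hu z). Qed.

Lemma v_ell z : is_ell (q P) 0 lb (v z) (fun x => z * v z x).
Proof. by case: (hv z). Qed.

Lemma u_lims z : cvgC 0^'- (u z) (U z) /\ cvgC 0^'- (derivC (u z)) (U' z).
Proof.
have [_ [a ha] [b hb] _ _] := eigen_ends (la0 hP) (q_left hP) (u_ell z).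
split; first by rewrite /U /limL (cvgC_lim ha); exact: ha.
by rewrite /U' /limL (cvgC_lim hb); exact: hb.
Qed.

Lemma v_lims z : cvgC 0^'+ (v z) (V z) /\ cvgC 0^'+ (derivC (v z)) (V' z).
Proof.
have [_ _ _ [a ha] [b hb]] := eigen_ends (lb0 hP) (q_right hP) (v_ell z).
split; first by rewrite /V /limR (cvgC_lim ha); exact: ha.
by rewrite /V' /limR (cvgC_lim hb); exact: hb.
Qed.

Lemma u_init z : cvgC la^'+ (u z) (sin (alpha P))%:C /\
  cvgC la^'+ (derivC (u z)) (cos (alpha P))%:C.
Proof. by have [_ h1 h2] := hu z; split; rewrite cvgCE; [exact: h1|exact: h2]. Qed.

Lemma v_init z : cvgC lb^'- (v z) (sin (beta P))%:C /\
  cvgC lb^'- (derivC (v z)) (cos (beta P))%:C.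
Proof. by have [_ h1 h2] := hv z; split; rewrite cvgCE; [exact: h1|exact: h2]. Qed.

Lemma UV_cvg (lam : R[i]) : [/\ cvgC (nbhs (lam : R[i]^o)) U (U lam),
  cvgC (nbhs (lam : R[i]^o)) U' (U' lam), cvgC (nbhs (lam : R[i]^o)) V (V lam) &
  cvgC (nbhs (lam : R[i]^o)) V' (V' lam)].
Proof.
have [a b] : cvgC (nbhs (lam : R[i]^o)) U (U lam) /\ cvgC (nbhs (lam : R[i]^o)) U' (U' lam).
  apply: (eigen_cvg (la0 hP) (q_left hP) lam (at_right_itv (la0 hP)) (at_left_itv (la0 hP)) u_ell
    (fun z => (u_init z).1) (fun z => (u_init z).2) (fun z => (u_lims z).1) (fun z => (u_lims z).2)).
have [c d] : cvgC (nbhs (lam : R[i]^o)) V (V lam) /\ cvgC (nbhs (lam : R[i]^o)) V' (V' lam).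
  apply: (eigen_cvg (lb0 hP) (q_right hP) lam (at_left_itv (lb0 hP)) (at_right_itv (lb0 hP)) v_ell
    (fun z => (v_init z).1) (fun z => (v_init z).2) (fun z => (v_lims z).1) (fun z => (v_lims z).2)).
by split.
Qed.

Lemma chiAB_left A B (f g : R -> R[i]) x : x \in `]la, 0[ ->
  chiAB P A B f g x = A * f x.
Proof.
rewrite in_itv/= => /andP[ax x0]; rewrite /chiAB !indicE mem_set/=; last first.
  by rewrite in_itv/= x0 (ltW ax).
rewrite memNset/=; last by rewrite in_itv/= ltNge (ltW x0).
by rewrite mulr0 mul0r addr0 mulr1.
Qed.

Lemma chiAB_right A B (f g : R -> R[i]) x : x \in `]0, lb[ ->
  chiAB P A B f g x = B * g x.
Proof.
rewrite in_itv/= => /andP[x0 xb]; rewrite /chiAB !indicE memNset/=; last first.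
  by rewrite in_itv/= ltNge (ltW x0) andbF.
rewrite mem_set/=; last by rewrite in_itv/= x0 (ltW xb).
by rewrite mulr0 mul0r add0r mulr1.
Qed.

Lemma chiAB0 A B (f g : R -> R[i]) : chiAB P A B f g 0 = 0.
Proof.
rewrite /chiAB !indicE memNset/=; last by rewrite in_itv/= ltxx andbF.
rewrite memNset/=; last by rewrite in_itv/= ltxx.
by rewrite !mulr0 !mul0r addr0.
Qed.

Section Scaled.
Variables (l r : R) (k : R[i]) (f y : R -> R[i]).
Hypothesis fE : forall x, x \in `]l, r[ -> f x = k * y x.

Lemma scaled_cvg (F : set_system R) {FF : Filter F} a :
  F (`]l, r[%classic : set R) -> cvgC F y a -> cvgC F f (k * a).
Proof.
move=> FI ya; apply: cvgC_on FI (fun x xI => esym (fE xI)) _.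
by apply: cvgCM; [exact: cvgC_cst|exact: ya].
Qed.

Lemma scaled_derivC x : derivableC y x -> x \in `]l, r[ -> derivC f x = k * derivC y x.
Proof.
move=> d xI; rewrite -derivC_scale//.
by have [_ ->] := derivC_eq fE xI.
Qed.

Lemma scaled_regular z : l < r -> L2 l r (q P) ->
  is_ell (q P) l r y (fun x => z * y x) ->
  is_ell (q P) l r f (fun x => z * f x) /\ regular_on P l r f.
Proof.
move=> lr hq ell; have [L1 L2' L3] := eigen_L2 lr hq ell.
have ellf : is_ell (q P) l r f (fun x => z * f x).
  apply: is_ell_eq (is_ell_scale k ell) => [x xI|]; first by rewrite fE.
  by apply: ae_eq_on_refl => x xI; rewrite fE//; ring.
have Lf : L2 l r f by apply: L2_eq (L2_scale k L1) => x xI; rewrite fE.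
split; first exact: ellf.
split; first exact: Lf.
  apply: L2_eq (L2_scale k L2') => x xI; rewrite scaled_derivC//.
  by case: ell => d _; exact: d.
by exists (fun x => z * f x) => //; exact: L2_scale.
Qed.
End Scaled.

Lemma chi_bvals z A B (f := chiAB P A B (u z) (v z)) :
  [/\ limL f 0 = A * U z, limL (derivC f) 0 = A * U' z,
      limR f 0 = B * V z & limR (derivC f) 0 = B * V' z] /\
  [/\ limR f la = A * (sin (alpha P))%:C, limR (derivC f) la = A * (cos (alpha P))%:C,
      limL f lb = B * (sin (beta P))%:C & limL (derivC f) lb = B * (cos (beta P))%:C].
Proof.
have fl := chiAB_left A B (u z) (v z); have fr := chiAB_right A B (u z) (v z).
have [du _] := u_ell z; have [dv _] := v_ell z.
have dl x : x \in `]la, 0[ -> derivC f x = A * derivC (u z) x.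
  by move=> xI; exact: (scaled_derivC fl (du _ xI) xI).
have dr x : x \in `]0, lb[ -> derivC f x = B * derivC (v z) x.
  by move=> xI; exact: (scaled_derivC fr (dv _ xI) xI).
have [ul ul'] := u_lims z; have [ui ui'] := u_init z.
have [vl vl'] := v_lims z; have [vi vi'] := v_init z.
have a0 := la0 hP; have b0 := lb0 hP.
split; split.
- exact: (cvgC_lim (scaled_cvg fl (at_left_itv a0) ul)).
- exact: (cvgC_lim (scaled_cvg dl (at_left_itv a0) ul')).
- exact: (cvgC_lim (scaled_cvg fr (at_right_itv b0) vl)).
- exact: (cvgC_lim (scaled_cvg dr (at_right_itv b0) vl')).
- exact: (cvgC_lim (scaled_cvg fl (at_right_itv a0) ui)).
- exact: (cvgC_lim (scaled_cvg dl (at_right_itv a0) ui')).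
- exact: (cvgC_lim (scaled_cvg fr (at_left_itv b0) vi)).
- exact: (cvgC_lim (scaled_cvg dr (at_left_itv b0) vi')).
Qed.

Local Notation iface z A B f1 h1 f2 h2 :=
  (interface (P := P) z (U z) (U' z) (V z) (V' z) A B f1 h1 f2 h2).

(** The differential equation and the conditions at the endpoints hold for all coefficients;
    only [interface] depends on them. *)
Lemma chi_graph z A B f1 h1 f2 h2 : iface z A B f1 h1 f2 h2 ->
  let f := chiAB P A B (u z) (v z) in
  graphL (@VecH R P f f1 f2) (@VecH R P (fun x => z * f x) (z *: f1 - h1) (z *: f2 - h2)).
Proof.
move=> [c1 c2 e1 e2] f.
have [[b1 b2 b3 b4] [b5 b6 b7 b8]] := chi_bvals z A B.
have [ell regl] := scaled_regular (chiAB_left A B (u z) (v z)) (la0 hP) (q_left hP) (u_ell z).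
have [elr regr] := scaled_regular (chiAB_right A B (u z) (v z)) (lb0 hP) (q_right hP) (v_ell z).
have Lf : L2 la lb f.
  apply: L2_glue (la0 hP) (lb0 hP) _ _ (chiAB0 _ _ _ _).
    by case: regl.
  by case: regr.
have dom : domL (@VecH R P f f1 f2).
  split; split=> //=.
  - by rewrite /f b5 b6; ring.
  - by rewrite /f b7 b8; ring.
  - by rewrite transfer1E /f b1 b2 b3 b4.
  - by rewrite transfer2E /f b1 b2 b3 b4.
split=> //; exists (@VecH R P f f1 f2); split; split=> //=.
- by split=> //; exact: ae_eq_on_refl.
- exact: L2_scale.
- by rewrite tr1E /f b1 b2 b3 b4 -e1 mulmxBl mul_scalar_mx scaleNr opprD opprK opprB
    addrCA [X in _ + X]addrC subrK.
- by rewrite tr2E /f b1 b2 b3 b4 -e2 mulmxBl mul_scalar_mx scaleNr opprD opprK opprB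
    addrCA [X in _ + X]addrC subrK.
Qed.

Lemma chi_resolvent z A B f1 h1 f2 h2 : iface z A B f1 h1 f2 h2 ->
  resolventL z (@VecH R P (fun=> 0) h1 h2)
    (@VecH R P (chiAB P A B (u z) (v z)) f1 f2).
Proof.
move=> /chi_graph h; eexists; first exact: h.
split=> /=.
- by apply: ae_eq_on_refl => x _; rewrite subrr.
- by rewrite opprB addrC subrK.
- by rewrite opprB addrC subrK.
Qed.

Lemma ae0_coef (l r : R) (w y : R -> R[i]) k (F : set_system R) {FF : ProperFilter F} (t : R) :
  F (`]l, r[%classic : set R) -> is_ell (q P) l r y w ->
  cvgC F y (sin t)%:C -> cvgC F (derivC y) (cos t)%:C ->
  ae_eq_on l r (fun x => k * y x) (fun=> 0) -> k = 0.
Proof.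
move=> FI ell ys yc k0; have [d _] := ell.
have z0 := is_ell_ae0 (is_ell_scale k ell) k0.
have ks : cvgC F (fun=> 0 : R[i]) (k * (sin t)%:C).
  apply: cvgC_on FI _ (cvgCM (cvgC_cst (l := k)) ys) => x xI.
  by have [] := z0 _ xI.
have kc : cvgC F (fun=> 0 : R[i]) (k * (cos t)%:C).
  apply: cvgC_on FI _ (cvgCM (cvgC_cst (l := k)) yc) => x xI.
  by have [_] := z0 _ xI; rewrite derivC_scale//; exact: d.
have s0 := cvgC_uniq ks (cvgC_cst (l := 0)); have c0 := cvgC_uniq kc (cvgC_cst (l := 0)).
rewrite -[k]mulr1 -[1]/((1 : R)%:C) -(cos2Dsin2 t) rmorphD !rmorphXn /= !expr2.
by rewrite mulrDr !mulrA c0 s0 !mul0r addr0.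
Qed.

Section NotEigenvalue.
Variable lam : R[i].
Hypothesis hlam : ~ eigenvalueL P lam.

Lemma iface_inj A B f1 f2 : iface lam A B f1 0 f2 0 ->
  [/\ A = 0, B = 0, f1 = 0 & f2 = 0].
Proof.
move=> /chi_graph /=; rewrite !subr0 => g.
have [f0 f10 f20] : eqH (@VecH R P (chiAB P A B (u lam) (v lam)) f1 f2) (zeroH P).
  apply: contrapT => n; apply: hlam; eexists; split; first exact: n.
  exact: g.
have [ui ui'] := u_init lam; have [vi vi'] := v_init lam.
split=> //.
- apply: (ae0_coef (at_right_itv (la0 hP)) (u_ell lam) ui ui').
  have := ae_eq_onS (lexx _) (ltW (lb0 hP)) f0.
  rewrite /ae_eq_on; apply: aeS => x h xI.
  by have := h xI; rewrite /= chiAB_left.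
- apply: (ae0_coef (at_left_itv (lb0 hP)) (v_ell lam) vi vi').
  have := ae_eq_onS (ltW (la0 hP)) (lexx _) f0.
  rewrite /ae_eq_on; apply: aeS => x h xI.
  by have := h xI; rewrite /= chiAB_right.
Qed.

End NotEigenvalue.

Local Notation smx z := (sysmx P z (U z) (U' z) (V z) (V' z)).

Lemma sysvec_surj (X : 'cV[R[i]]_((1 + 1) + (Nstar P + Mstar P))) :
  exists A B f1 f2, X = sysvec A B f1 f2.
Proof.
exists (usubmx X 0 0), (usubmx X 1 0), (usubmx (dsubmx X)), (dsubmx (dsubmx X)).
rewrite /sysvec vsubmxK -[LHS]vsubmxK; congr col_mx.
apply/colP => i; rewrite [RHS]mxE; case: i => [[|[|//]]] hi /=.
  by congr (usubmx X _ 0); apply: val_inj.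
by congr (usubmx X _ 0); apply: val_inj.
Qed.

Lemma sysvec0 : sysvec (P := P) 0 0 0 0 = 0.
Proof.
rewrite /sysvec (_ : col2 0 0 = 0) ?col_mx0//.
by apply/colP => i; rewrite !mxE; case: ifP.
Qed.

Lemma smx_unit lam : ~ eigenvalueL P lam -> smx lam \in unitmx.
Proof.
move=> hlam; apply: inj_unitmx => X; have [A [B [f1 [f2 ->]]]] := sysvec_surj X.
rewrite -[in RHS]sysvec0 -{1}sysvec0 => /sysmxP/(iface_inj hlam)[-> -> -> ->] //.
Qed.

(** [Dfun] is the determinant of the 2 x 2 system left after elimination, so a zero gives
    coefficients A, B, not both 0, which extend to the kernel of [sysmx]. *)
Lemma Dfun_neq0 z : off (cv P) z -> off (dv P) z -> smx z \in unitmx ->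
  Dfun P u v z != 0.
Proof.
move=> oc od Uz; apply/eqP => D0.
pose p := V' z - mu P z * V z; pose s := U z + nu P z * U' z.
have {}D0 : U' z * V z - p * s = 0 by exact: D0.
suff [A [B [n0 e1 e2]]] : exists A B, [/\ A != 0 \/ B != 0,
    p * B = U' z * A & s * A = V z * B].
  have [|f1 [c1 g1]] := @transfer1_solvable _ _ hP z (A * U z) (A * U' z) (B * V z) (B * V' z) oc.
    by move: e1; rewrite /p => e1; rewrite (mulrC A) -e1; ring.
  have [|f2 [c2 g2]] := @transfer2_solvable _ _ hP z (A * U z) (A * U' z) (B * V z) (B * V' z) od.
    by move: e2; rewrite /s => e2; rewrite (mulrC B) -e2; ring.
  have : smx z *m sysvec A B f1 f2 = 0.
    by rewrite -sysvec0; apply/sysmxP.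
  move=> /(canRL (mulKmx Uz)); rewrite mulmx0 -sysvec0 => /eq_col_mx[/colP E _].
  have := E 0; have := E 1; rewrite !mxE /= => B0 A0.
  by case: n0; rewrite ?A0 ?B0 eqxx.
(* (p, U') is a kernel vector unless it is 0; then (V, s) is one, unless it is 0 too. *)
have [p0|p0] := eqVneq p 0; have [u0|u0] := eqVneq (U' z) 0.
- have [s0|s0] := eqVneq s 0; have [v0|v0] := eqVneq (V z) 0.
  + by exists 1, 1; rewrite p0 u0 s0 v0 !mul0r oner_neq0; split=> //; left.
  + by exists 1, 0; rewrite u0 s0 !mul0r !mulr0 oner_neq0; split=> //; left.
  + by exists 0, 1; rewrite p0 v0 !mul0r !mulr0 oner_neq0; split=> //; right.
  + by exists (V z), s; rewrite p0 u0 !mul0r; split=> //; [left|rewrite mulrC].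
- exists p, (U' z); split; [by right|by rewrite mulrC|].
  by apply/eqP; rewrite eq_sym -subr_eq0 (mulrC (V z)) (mulrC s) D0.
- exists p, (U' z); split; [by left|by rewrite mulrC|].
  by apply/eqP; rewrite eq_sym -subr_eq0 (mulrC (V z)) (mulrC s) D0.
- exists p, (U' z); split; [by left|by rewrite mulrC|].
  by apply/eqP; rewrite eq_sym -subr_eq0 (mulrC (V z)) (mulrC s) D0.
Qed.

Lemma coefAB_iface z A B f1 h1 f2 h2 : nonpole P z -> Dfun P u v z != 0 ->
  iface z A B f1 h1 f2 h2 -> col2 A B = coefAB u v h1 h2 z.
Proof.
move=> [oc od og ode] D0 [c1 c2 e1 e2].
have := transfer1_elim hP oc og c1 e1; have := transfer2_elim hP od ode c2 e2.
rewrite /coefAB /Lambda; set p1 := dot h1 _; set p2 := dot h2 _ => E2 E1.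
apply/colP => i; rewrite -scalemxAl !mxE !big_ord_recl big_ord0 !mxE /= addr0.
rewrite -/(U z) -/(U' z) -/(V z) -/(V' z) -E1 -E2.
case: ifP => _.
  apply: (mulfI D0); rewrite mulVKf// /Dfun -/(U z) -/(U' z) -/(V z) -/(V' z); ring.
apply: (mulfI D0); rewrite mulVKf// /Dfun -/(U z) -/(U' z) -/(V z) -/(V' z); ring.
Qed.

Lemma near_off n (x : 'cV[R]_n) (lam : R[i]) : \forall z \near (lam : R[i]^o)^', off x z.
Proof.
have h i : \forall z \near (lam : R[i]^o)^', (z : R[i]) != (x i 0)%:C.
  have [<-|n0] := eqVneq lam (x i 0)%:C.
    exact: nbhs_dnbhs_neq.
  apply: (@cvg_within _ _ _).
  have : cvgC (nbhs (lam : R[i]^o)) (fun z => z - (x i 0)%:C) (lam - (x i 0)%:C).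
    by apply: cvgCB; [rewrite cvgCE; exact: cvg_id|exact: cvgC_cst].
  move=> /cvgC_neq0; rewrite subr_eq0 => /(_ n0).
  by apply: filterS => z; rewrite subr_eq0.
exact: filter_forall.
Qed.

Lemma near_nonpole (lam : R[i]) : \forall z \near (lam : R[i]^o)^', nonpole P z.
Proof.
by near=> z; split; near: z; exact: near_off.
Unshelve. all: by end_near.
Qed.

Lemma smx_cvg (lam : R[i]) : cvgMx (lam : R[i]^o)^' (fun z => smx z) (smx lam).
Proof.
have dn (g : R[i] -> R[i]) a : cvgC (nbhs (lam : R[i]^o)) g a -> cvgC (lam : R[i]^o)^' g a.
  by rewrite !cvgCE => h; apply: cvg_trans h; apply: cvg_app; exact: cvg_within.
have [/dn hU /dn hU' /dn hV /dn hV'] := UV_cvg lam.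
have hz : cvgC (lam : R[i]^o)^' id lam by apply: dn; rewrite cvgCE; exact: cvg_id.
have row (a b : R[i] -> R[i]) a0 b0 : cvgC (lam : R[i]^o)^' a a0 ->
    cvgC (lam : R[i]^o)^' b b0 ->
    cvgMx (lam : R[i]^o)^' (fun z => row2 (a z) (b z)) (row2 a0 b0).
  move=> ha hb i j; rewrite mxE; under [X in cvgC _ X]eq_fun do rewrite mxE.
  by case: ifP => _; [exact: ha|exact: hb].
have c0 (l : R[i]) : cvgC (lam : R[i]^o)^' (fun=> l) l by exact: cvgC_cst.
have aff (a b c d : R[i] -> R[i]) a0 b0 c0' d0 : 
    cvgC (lam : R[i]^o)^' a a0 -> cvgC (lam : R[i]^o)^' b b0 ->
    cvgC (lam : R[i]^o)^' c c0' -> cvgC (lam : R[i]^o)^' d d0 ->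
    [/\ cvgC (lam : R[i]^o)^' (fun z => bc1 P (a z) (b z) (c z) (d z)) (bc1 P a0 b0 c0' d0),
     cvgC (lam : R[i]^o)^' (fun z => bc2 P (a z) (b z) (c z) (d z)) (bc2 P a0 b0 c0' d0),
     cvgC (lam : R[i]^o)^' (fun z => btr1 P (a z) (b z) (c z) (d z)) (btr1 P a0 b0 c0' d0) &
     cvgC (lam : R[i]^o)^' (fun z => btr2 P (a z) (b z) (c z) (d z)) (btr2 P a0 b0 c0' d0)].
  move=> ha hb hc hd; rewrite /bc1 /bc2 /btr1 /btr2; split; case: ifP => _.
  - by apply: cvgCD; [exact: cvgCN|apply: cvgCM; [exact: c0|exact: cvgCB]].
  - by apply: cvgCB; [exact: cvgCB|apply: cvgCM; [exact: c0|exact: hc]].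
  - by apply: cvgCB; [exact: hb|apply: cvgCM; [exact: c0|exact: cvgCB]].
  - by apply: cvgCD; [apply: cvgCN; exact: cvgCB|apply: cvgCM; [exact: c0|exact: hb]].
  - exact: cvgCB.
  - exact: hc.
  - exact: cvgCB.
  - exact: hb.
have [a1 a2 a3 a4] := aff _ _ (fun=> 0) (fun=> 0) _ _ _ _ hU hU' (c0 0) (c0 0).
have [b1 b2 b3 b4] := aff (fun=> 0) (fun=> 0) _ _ _ _ _ _ (c0 0) (c0 0) hV hV'.
have diag n (d : 'cV[R]_n) : cvgMx (lam : R[i]^o)^' (fun z => z%:M - diagC d) (lam%:M - diagC d).
  apply: cvgMx_B; last exact: cvgMx_cst.
  move=> i j; rewrite mxE; under [X in cvgC _ X]eq_fun do rewrite mxE.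
  by case: eqP => _; [exact: hz|exact: c0].
apply: cvgMx_block.
- by apply: cvgMx_col; [exact: (row _ _ _ _ a1 b1)|exact: (row _ _ _ _ a2 b2)].
- exact: cvgMx_cst.
- apply: cvgMx_col => i j; rewrite mxE; under [X in cvgC _ X]eq_fun do rewrite mxE.
    by apply: cvgCN; exact: (cvgMx_mul (cvgMx_cst (M0 := vecC (wt1 P))) (row _ _ _ _ a3 b3)).
  by apply: cvgCN; exact: (cvgMx_mul (cvgMx_cst (M0 := vecC (wt2 P))) (row _ _ _ _ a4 b4)).
- by apply: cvgMx_block; [exact: diag|exact: cvgMx_cst|exact: cvgMx_cst|exact: diag].
Qed.

End Resolvent.

Unset Implicit Arguments.
Set Strict Implicit.

Theorem theorem6p2 (R : realType) (P : problem R) (hP : standing P)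
  (u v : R[i] -> R -> R[i])
  (hu : forall z : R[i], is_uminus P z (u z))
  (hv : forall z : R[i], is_vplus P z (v z))
  (lam : R[i]) (hlam : ~ eigenvalueL P lam)
  (h1 : 'cV[R[i]]_(Nstar P)) (h2 : 'cV[R[i]]_(Mstar P)) :
  (off (cv P) lam -> off (dv P) lam -> Dfun P u v lam != 0) /\
  exists (A B : R[i]) (f1 : 'cV[R[i]]_(Nstar P)) (f2 : 'cV[R[i]]_(Mstar P)),
    let f := chiAB P A B (u lam) (v lam) in
    let F := @VecH R P f f1 f2 in
    let H := @VecH R P (fun=> 0) h1 h2 in
    [/\ resolventL lam H F /\ (forall G, resolventL lam H G -> eqH G F),
        nonpole P lam -> col2 A B = coefAB u v h1 h2 lam,
        ~ nonpole P lam ->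
          ((coefAB u v h1 h2 z 0 0 : R[i]^o)
             @[z --> (lam : R[i]^o)^'] --> (A : R[i]^o)) /\
          ((coefAB u v h1 h2 z 1 0 : R[i]^o)
             @[z --> (lam : R[i]^o)^'] --> (B : R[i]^o)),
        - tr1 P f *: vecC (wt1 P) + (lam%:M - diagC (dg1 P)) *m f1 = h1 &
        - tr2 P f *: vecC (wt2 P) + (lam%:M - diagC (dg2 P)) *m f2 = h2].
Proof.
have smxU := smx_unit hP hu hv hlam.
split=> [oc od|]; first exact: (Dfun_neq0 hP oc od smxU).
pose M z := sysmx P z (limL (u z) 0) (limL (derivC (u z)) 0)
  (limR (v z) 0) (limR (derivC (v z)) 0).
pose rhs := sysvec (P := P) 0 0 h1 h2.
have [A [B [f1 [f2 XE]]]] := sysvec_surj (invmx (M lam) *m rhs).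
have ifc : interface lam (limL (u lam) 0) (limL (derivC (u lam)) 0)
    (limR (v lam) 0) (limR (derivC (v lam)) 0) A B f1 h1 f2 h2.
  by apply/sysmxP; rewrite -XE mulKVmx.
have res := chi_resolvent hP hu hv ifc.
have [[b1 b2 b3 b4] _] := chi_bvals hP hu hv lam A B.
exists A, B, f1, f2 => f F H.
have limX : cvgMx (lam : R[i]^o)^' (fun z => invmx (M z) *m rhs) (invmx (M lam) *m rhs).
  apply: cvgMx_mul; last exact: cvgMx_cst.
  by apply: cvgMx_inv smxU; exact: (smx_cvg hP hu hv).
have limAB : cvgMx (lam : R[i]^o)^' (fun z => coefAB u v h1 h2 z) (col2 A B).
  move=> i j; rewrite ord1.
  have -> : col2 A B i 0 = (invmx (M lam) *m rhs) (lshift _ i) 0.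
    by rewrite XE /sysvec (@col_mxEu _ 2 (Nstar P + Mstar P)).
  apply: cvgC_near (limX (lshift _ i) 0).
  have nM := cvgMx_unit (smx_cvg hP hu hv (lam := lam)) smxU.
  near=> z.
  have Uz : M z \in unitmx by near: z; exact: nM.
  have np : nonpole P z by near: z; exact: near_nonpole.
  have [A' [B' [g1 [g2 XE']]]] := sysvec_surj (invmx (M z) *m rhs).
  have [oc od _ _] := np.
  rewrite -(coefAB_iface hP np (Dfun_neq0 hP oc od Uz) (A := A') (B := B') (f1 := g1) (f2 := g2)).
    by rewrite XE' /sysvec (@col_mxEu _ 2 (Nstar P + Mstar P)).
  by apply/sysmxP; rewrite -XE' mulKVmx.
split.
- by split=> // G hG; exact: (resolvent_uniq hP hlam hG res).
- move=> np; have [oc od _ _] := np.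
  exact: (coefAB_iface hP np (Dfun_neq0 hP oc od smxU) ifc).
- move=> _; split.
    by have := limAB 0 0; rewrite cvgCE mxE.
  by have := limAB 1 0; rewrite cvgCE mxE.
- by case: ifc => _ _ <- _; rewrite tr1E b1 b2 b3 b4.
- by case: ifc => _ _ _ <-; rewrite tr2E b1 b2 b3 b4.
Unshelve. all: by end_near.
Qed.
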